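(* Let $B>0$, $\sigma^2>0$ and $\kappa>2$ be fixed. Let $\mathcal E_B$ be the centered Fourier--Sobolev ellipsoid $$\mathcal E_B=\{f:\{0,1\}^d\to\mathbb R:\ \widehat f(\emptyset)=0,\ I^{(2)}(f)\leqslant B\}.$$ Then there exist universal constants $0<c<C<\infty$ and an integer $D_0\geqslant 1$ depending only on $B$, $\sigma^2$ and $\kappa$, such that, for every pair of positive integers $(d,n)$ satisfying $d\geqslant\kappa(D^*(d,n)+1)$ and $D^*(d,n)\geqslant D_0$, $$c\,\frac{B}{D^*(d,n)}\leqslant R_n^*(\mathcal E_B)\leqslant C\,\frac{B}{D^*(d,n)}.$$ In particular, along any sequence of pairs $(d,n)$ (with $d$ allowed to depend on $n$) such that $D^*(d,n)\to\infty$ and $d\geqslant\kappa(D^*(d,n)+1)$ for all sufficiently large $n$ (with $\kappa>2$, $B>0$, $\sigma^2>0$ fixed), both conditions are satisfied for all sufficiently large $n$ and the two-sided bound is therefore valid. Moreover, the upper bound is attained by the empirical Fourier projection estimator $\widetilde f_{D_\sharp}$ with truncation degree $D_\sharp=D_\sharp(d,n,B,V)$ and $V=\sigma^2+B/4$.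
   Context: Model. One observes $Y_j=f(X_j)+\varepsilon_j$, $j=1,\dots,n$, where $X_1,\dots,X_n$ are i.i.d. uniform on $\{0,1\}^d$ (law $\mu$), and $\varepsilon_1,\dots,\varepsilon_n$ are i.i.d., centered, independent of the design, with $\mathbb E e^{t\varepsilon_j}\leqslant\exp(\sigma^2t^2/2)$ for all $t\in\mathbb R$. Let $\mathcal P_{\sigma^2}$ be the class of all such noise laws (centered, satisfying this sub-Gaussian bound). Risk. $\|g\|_2^2=2^{-d}\sum_{x\in\{0,1\}^d}g(x)^2$. For an estimator $\widehat f$ based on $(X_j,Y_j)_{j=1}^n$, $R_{P_\varepsilon}(\widehat f,f)=\mathbb E\|\widehat f-f\|_2^2$, expectation over design and noise with noise law $P_\varepsilon$. For a class $\mathcal A$ of functions, $R_n^*(\mathcal A)=\inf_{\widehat f}\sup_{f\in\mathcal A}\sup_{P_\varepsilon\in\mathcal P_{\sigma^2}}R_{P_\varepsilon}(\widehat f,f)$, the infimum being over all estimators based on the sample. ''The upper bound is attained by $\widehat f$'' means that $\sup_{f\in\mathcal A}\sup_{P_\varepsilon\in\mathcal P_{\sigma^2}}R_{P_\varepsilon}(\widehat f,f)$ satisfies the stated upper bound. Fourier--Walsh notation. For $S\subseteq[d]=\{1,\dots,d\}$, $\chi_S(x)=\prod_{i\in S}(2x_i-1)$, $\chi_\emptyset\equiv1$; $\widehat f(S)=\mathbb E[f(X)\chi_S(X)]$ with $X\sim\mu$. The Fourier--Sobolev energy is $I^{(2)}(f)=4\sum_{S\ne\emptyset}|S|\widehat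 f(S)^2$, equivalently $I^{(2)}(f)=\sum_{i=1}^d\mathbb E[(\Delta_if(X))^2]$, where $\Delta_if(x)=f(x^{i\to1})-f(x^{i\to0})$ and $x^{i\to a}$ is $x$ with $i$-th coordinate replaced by $a$. Resolvable degree. $N(d,D)=\sum_{k=0}^D\binom dk$ and $D^*(d,n)=\max\{0\leqslant D\leqslant d: N(d,D)\leqslant n\}$. Estimator. $\widetilde f(S)=\frac1n\sum_{j=1}^nY_j\chi_S(X_j)$ and $\widetilde f_D(x)=\sum_{|S|\leqslant D}\widetilde f(S)\chi_S(x)$. The balanced cutoff, defined when $D^*(d,n)\geqslant1$ and the set is nonempty, is $$D_\sharp(d,n,B,V)=\max\Big\{0\leqslant D\leqslant D^*(d,n):\ \frac{V\,N(d,D)}{n}\leqslant\frac{B}{4D^*(d,n)}\Big\}.$$ *)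

(* Defs.v *)
From HB Require Import structures.
From mathcomp Require Import all_boot all_order all_algebra.
From mathcomp Require Import all_classical all_reals all_analysis.

Set Implicit Arguments.
Unset Strict Implicit.
Unset Printing Implicit Defensive.

Import Order.TTheory GRing.Theory Num.Theory.
Import numFieldNormedType.Exports.

Local Open Scope classical_set_scope.
Local Open Scope ring_scope.

Section iid_power.
Context (dsp : measure_display) (T : measurableType dsp) (R : realType).

Definition cons_tuple n (z : T * n.-tuple T) : n.+1.-tuple T :=
  [tuple of z.1 :: z.2].

Lemma measurable_cons_tuple n : measurable_fun setT (@cons_tuple n).
Proof. exact: measurable_cons. Qed.

HB.instance Definition _ n :=
  isMeasurableFun.Build _ _ _ _ (@cons_tuple n) (@measurable_cons_tuple n).

(* The n-fold product of P, that is, the law of an i.i.d. n-sample from P;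
   the library has the product sigma-algebra on n.-tuple T but no product
   measure on it. *)
Fixpoint iid_power (P : probability T R) (n : nat) :
    probability (n.-tuple T) R :=
  match n with
  | 0 => \d_([tuple] : 0.-tuple T)
  | m.+1 => distribution (P \x iid_power P m)%E (@cons_tuple m)
  end.

Lemma iid_powerE (P : probability T R) n (A : 'I_n -> set T) :
    (forall i, measurable (A i)) ->
  iid_power P n [set z | forall i, A i (tnth z i)] = (\prod_(i < n) P (A i))%E.
Proof.
elim: n A => [|n IH] A mA.
  rewrite /= big_ord0 /dirac/= indicE mem_set//; by case.
rewrite big_ord_recl /= /distribution /pushforward.
have -> : @cons_tuple n @^-1` [set z | forall i, A i (tnth z i)] =
  A ord0 `*` [set z | forall i, A (lift ord0 i) (tnth z i)].
  apply/seteqP; split=> [[x z] /= h|[x z] /= [h0 h] i].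
    split=> [|i]; first exact: (h ord0).
    by have := h (lift ord0 i); rewrite /cons_tuple tnthS.
  case: (unliftP ord0 i) => [j|] ->; last exact: h0.
  by rewrite /cons_tuple tnthS; exact: h.
have m : measurable [set z : n.-tuple T | forall i, A (lift ord0 i) (tnth z i)].
  have -> : [set z : n.-tuple T | forall i, A (lift ord0 i) (tnth z i)] =
      \bigcap_(i in [set: 'I_n])
        ((fun z : n.-tuple T => tnth z i) @^-1` A (lift ord0 i)).
    by apply/seteqP; split=> z /= h i; move: (h i) => //; apply.
  apply: fin_bigcap_measurable => // i _.
  by rewrite -[X in measurable X]setTI; apply: measurable_tnth.
rewrite /= product_measure1E; [|exact: mA|exact: m].
congr (_ * _)%E; exact: (IH (fun i => A (lift ord0 i))).
Qed.

End iid_power.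

(* Coordinates are indexed by 'I_d rather than {1, ..., d}. *)
Notation cube d := (d.-tuple bool).

Section cube_law.
Context (R : realType) (d : nat).

Let half_pow_ge0 : 0 <= 2 ^- d :> R. Proof. by rewrite invr_ge0 exprn_ge0. Qed.

Definition cube_law : set (cube d) -> \bar R :=
  mscale (NngNum half_pow_ge0)
    (msum (fun k : nat =>
      \d_(nth (nseq_tuple d false) (enum {: cube d}) k)) #|{: cube d}|).

HB.instance Definition _ := Measure.on cube_law.

Let cube_law_setT : cube_law setT = 1%E.
Proof.
rewrite /cube_law /mscale/= /msum.
under eq_bigr do rewrite /= diracT.
rewrite sumEFin big_const_ord iter_addr addr0 card_tuple card_bool.
by rewrite -EFinM natrX mulVf// expf_neq0.
Qed.

HB.instance Definition _ :=
  Measure_isProbability.Build _ _ _ cube_law cube_law_setT.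

Lemma cube_lawE (A : set (cube d)) :
  cube_law A = ((2 ^- d)%:E * \sum_(x : cube d) \d_x A)%E.
Proof.
rewrite /cube_law /mscale /= /msum; congr (_ * _)%E.
rewrite cardE -(big_mkord xpredT (fun k =>
  \d_(nth (nseq_tuple d false) (enum {: cube d}) k) A)%E).
by rewrite -(big_nth _ xpredT (fun x => \d_x A)) big_enum.
Qed.

End cube_law.

Arguments cube_law : clear implicits.

Section fourier_walsh.
Context (R : realType) (d : nat).
Implicit Types (f g : cube d -> R) (S : {set 'I_d}) (x : cube d).

Definition walsh S x : R := \prod_(i in S) (2 * (tnth x i)%:R - 1).

Definition fourier f S : R := 2 ^- d * \sum_(x : cube d) f x * walsh S x.

Definition sobolev_energy f : R :=
  4 * \sum_(S : {set 'I_d} | S != finset.set0) #|S|%:R * fourier f S ^+ 2.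

Definition l2norm_sq g : R := 2 ^- d * \sum_(x : cube d) g x ^+ 2.

Definition sobolev_ellipsoid (B : R) : set (cube d -> R) :=
  [set f | fourier f finset.set0 = 0 /\ sobolev_energy f <= B].

End fourier_walsh.

Arguments sobolev_ellipsoid {R} d B _.

Definition Ndim (d D : nat) : nat := \sum_(0 <= k < D.+1) 'C(d, k).

(* For n >= 1 the set contains D = 0, so this is a genuine maximum. *)
Definition Dstar (d n : nat) : nat :=
  (\max_(D < d.+1 | Ndim d D <= n) D)%N.

Section model.
Context (R : realType) (d n : nat).

Definition sub_gaussian_noise (s2 : R) : set (probability R R) :=
  [set P : probability R R | P.-integrable setT (fun e : R => e%:E) /\
           'E_P[fun e : R => e]%E = 0%E /\
           forall t : R,
             ('M_P (fun e : R => e) t <= (expR (s2 * t ^+ 2 / 2))%:E)%E].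

(* The law of ((X_1, e_1), ..., (X_n, e_n)): the pairs are independent, each
   with X_j uniform on the cube and independent of e_j. *)
Definition design_noise_law (P : probability R R) :
    probability (n.-tuple (cube d * R)) R :=
  iid_power (cube_law R d \x P)%E n.

Definition sample_of (f : cube d -> R) (z : n.-tuple (cube d * R)) :
    n.-tuple (cube d * R) :=
  [tuple of map (fun xe => (xe.1, f xe.1 + xe.2)) z].

Definition is_estimator (fh : n.-tuple (cube d * R) -> cube d -> R) : Prop :=
  forall x : cube d, measurable_fun setT (fun s => fh s x).

Definition risk (P : probability R R)
    (fh : n.-tuple (cube d * R) -> cube d -> R) (f : cube d -> R) : \bar R :=
  ('E_(design_noise_law P)[fun z =>
      l2norm_sq (fun x => fh (sample_of f z) x - f x)%R])%E.

Definition worst_risk (s2 : R) (A : set (cube d -> R))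
    (fh : n.-tuple (cube d * R) -> cube d -> R) : \bar R :=
  ereal_sup [set ereal_sup [set risk P fh f | P in sub_gaussian_noise s2]
            | f in A].

Definition minimax_risk (s2 : R) (A : set (cube d -> R)) : \bar R :=
  ereal_inf [set worst_risk s2 A fh | fh in is_estimator].

Definition emp_fourier (s : n.-tuple (cube d * R)) (S : {set 'I_d}) : R :=
  n%:R^-1 * \sum_(j < n) (tnth s j).2 * walsh R S (tnth s j).1.

Definition emp_projection (D : nat) (s : n.-tuple (cube d * R)) (x : cube d) :
    R :=
  \sum_(S : {set 'I_d} | (#|S| <= D)%N) emp_fourier s S * walsh R S x.

Definition cutoff_admissible (B V : R) (D : nat) : bool :=
  (D <= Dstar d n)%N &&
  (V * (Ndim d D)%:R / n%:R <= B / (4 * (Dstar d n)%:R)).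

(* Meaningful only when Dstar d n >= 1 and some D is admissible. *)
Definition balanced_cutoff (B V : R) : nat :=
  (\max_(D < (Dstar d n).+1 | cutoff_admissible B V D) D)%N.

End model.

Arguments minimax_risk {R d} n s2 A.
Arguments emp_projection {R d n} D s x.
Arguments cutoff_admissible {R} d n B V D.
Arguments balanced_cutoff {R} d n B V.

(* Main.v *)
Require Import Defs.
From HB Require Import structures.
From mathcomp Require Import all_boot all_order all_algebra.
From mathcomp Require Import all_classical all_reals all_analysis.
From mathcomp Require Import measurable_realfun ring lra zify.

Set Implicit Arguments.
Unset Strict Implicit.
Unset Printing Implicit Defensive.

Import Order.TTheory GRing.Theory Num.Theory.
Import numFieldNormedType.Exports.

Local Open Scope classical_set_scope.
Local Open Scope ring_scope.

(** Both bounds are obtained Fourier coefficient by Fourier coefficient. Write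
    [m] for [Dstar d n] and [V = s2 + B / 4].

    Upper bound. By Parseval the loss of the projection estimator of degree
    [D] splits into the squared errors on the coefficients with [|S| <= D] and
    the bias, which is the sum of the squared coefficients with [|S| > D]. An
    empirical coefficient is a mean of [n] independent unbiased terms, each of
    variance at most the mean of [f ^ 2] plus the noise variance, so the
    stochastic part is at most a constant times [V * N(d, D) / n]
    ([coeff_risk]); on the ellipsoid the bias is at most [B / (4 (D + 1))]
    ([ellipsoid_tail]). The balanced cutoff keeps the first part of order
    [B / m] by definition. It also keeps the bias of that order, because the
    cutoff is at least [m / 2]: when [d >= kappa (m + 1)] with [kappa > 2], the
    dimensions [N(d, D)] grow at least geometrically with ratio [kappa - 1] up
    to [D = m], so [N(d, m / 2) / n] is exponentially small in [m]
    ([Ndim_growth], [geometric_beats_linear]).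

    Lower bound. Take Gaussian noise of variance [s2] and, for [k = m + 1], the
    functions whose coefficients are [+- a] on the [M = N(d, k) - 1] nonempty
    sets of size at most [k], with [a ^ 2 = B / (4 k M)], which places them in
    the ellipsoid. By maximality of [m] we have [n <= M], so
    [n a ^ 2 / (2 s2) <= B / (8 k s2)] is small when [m] is large: flipping a
    single sign barely changes the law of the sample, and no estimator can
    determine that sign reliably. Assouad's averaging over all sign patterns
    ([assouad]) then gives risk at least [M a ^ 2 / 2 = B / (8 k)]. The
    comparison of two sign patterns ([two_point_risk]) is made with explicit
    likelihoods with respect to the law of the sample for [f = 0], whose
    geometric mean is again a likelihood up to an explicit constant. *)

(** * Fourier-Walsh analysis on the cube *)

Section walsh_analysis.
Context (R : realType) (d : nat).
Implicit Types (f g : cube d -> R) (S T : {set 'I_d}) (x y : cube d).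

Lemma walsh_sqr S x : walsh R S x ^+ 2 = 1.
Proof.
rewrite /walsh -prodrXl big1// => i _.
by case: (tnth x i) => /=; ring.
Qed.

Definition flip_coord (i : 'I_d) x : cube d :=
  [tuple (if j == i then ~~ tnth x j else tnth x j) | j < d].

Lemma flip_coordK i : involutive (flip_coord i).
Proof.
move=> x; apply: eq_from_tnth => j; rewrite !tnth_mktuple.
by case: eqP => // _; rewrite negbK.
Qed.

Lemma walsh_flip_in i S x : i \in S ->
  walsh R S (flip_coord i x) = - walsh R S x.
Proof.
move=> iS; rewrite /walsh (bigD1 i)//= [in RHS](bigD1 i)//= -mulNr.
congr (_ * _).
  by rewrite tnth_mktuple eqxx; case: (tnth x i) => /=; ring.
by apply: eq_bigr => j /andP[_ ji]; rewrite tnth_mktuple (negbTE ji).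
Qed.

Lemma walsh_flip_notin i S x : i \notin S ->
  walsh R S (flip_coord i x) = walsh R S x.
Proof.
move=> iS; apply: eq_bigr => j jS; rewrite tnth_mktuple ifN//.
by apply: contra iS => /eqP <-.
Qed.

Let pow2_neq0 : 2 ^+ d != 0 :> R. Proof. by rewrite expf_neq0. Qed.

(** Flipping a coordinate that belongs to exactly one of the two sets is a
    measure-preserving change of variables that negates the product. *)
Lemma walsh_orthonormal S T :
  2 ^- d * \sum_(x : cube d) walsh R S x * walsh R T x = (S == T)%:R.
Proof.
have [<-|neqST] := eqVneq S T.
  under eq_bigr do rewrite -expr2 walsh_sqr.
  by rewrite sumr_const card_tuple card_bool natrX mulVf.
have [i iST] : exists i, (i \in S) != (i \in T).
  apply/existsP; rewrite -negb_forall; apply: contra neqST => /forallP h.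
  by apply/eqP/setP => i; exact/eqP/h.
set s := \sum_x _; suff sN : s = - s.
  by rewrite (_ : s = 0) ?mulr0//; lra.
rewrite {1}/s (reindex_inj (inv_inj (flip_coordK i))) -sumrN.
apply: eq_bigr => x _ /=.
move: iST; case iS: (i \in S); case iT: (i \in T) => // _.
  by rewrite walsh_flip_in// walsh_flip_notin ?iT// mulNr.
by rewrite [in X in _ * X]walsh_flip_in// walsh_flip_notin ?iS// mulrN.
Qed.

(** Summing [walsh S x * walsh S y] over [S] expands the product of the
    factors [1 + (2 x_i - 1) (2 y_i - 1)], which vanishes as soon as [x] and
    [y] differ somewhere. *)
Lemma walsh_complete x y :
  \sum_S walsh R S x * walsh R S y = 2 ^+ d * (x == y)%:R.
Proof.
pose a (i : 'I_d) : R := (2 * (tnth x i)%:R - 1) * (2 * (tnth y i)%:R - 1).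
transitivity (\prod_(i < d) (a i + 1)).
  rewrite bigA_distr; apply: eq_bigr => S _.
  rewrite /walsh -big_split/= big_mkcond/=.
  by apply: eq_bigr => i _; case: ifP.
have [xy|neqxy] := eqVneq x y.
  rewrite mulr1 (eq_bigr (fun=> 2)); first by rewrite prodr_const card_ord.
  by move=> i _; rewrite /a xy; case: (tnth y i) => /=; ring.
have [i xyi] : exists i, tnth x i != tnth y i.
  apply/existsP; rewrite -negb_forall; apply: contra neqxy => /forallP h.
  by apply/eqP/eq_from_tnth => i; exact/eqP/h.
rewrite mulr0 (bigD1 i)//= [X in X * _](_ : _ = 0) ?mul0r//.
by move: xyi; rewrite /a; case: (tnth x i); case: (tnth y i) => //= _; ring.
Qed.

Lemma fourier_inversion f x : f x = \sum_S fourier f S * walsh R S x.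
Proof.
rewrite /fourier.
under eq_bigr do rewrite -mulrA mulr_suml.
rewrite -mulr_sumr exchange_big/= (bigD1 x)//=.
rewrite [X in _ + X]big1 => [|y yx].
  under eq_bigr do rewrite -mulrA.
  by rewrite -mulr_sumr walsh_complete eqxx mulr1 addr0 mulrC mulfK.
under eq_bigr do rewrite -mulrA.
by rewrite -mulr_sumr walsh_complete (negbTE yx) !mulr0.
Qed.

Lemma fourier_walsh_sum (P : pred {set 'I_d}) (c : {set 'I_d} -> R) S :
  fourier (fun x => \sum_(T | P T) c T * walsh R T x) S =
  if P S then c S else 0.
Proof.
rewrite /fourier; under eq_bigr do rewrite mulr_suml.
rewrite exchange_big/= mulr_sumr.
transitivity (\sum_(T | P T) c T * (T == S)%:R).
  apply: eq_bigr => T _; rewrite -walsh_orthonormal mulrCA; congr (_ * _).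
  by rewrite mulr_sumr; apply: eq_bigr => x _; rewrite mulrA.
rewrite big_mkcond (bigD1 S)//= eqxx mulr1 big1 ?addr0// => T TS.
by rewrite (negbTE TS) mulr0 if_same.
Qed.

Lemma fourierB f g S :
  fourier (fun x => f x - g x) S = fourier f S - fourier g S.
Proof.
rewrite /fourier -mulrBr -sumrB; congr (_ * _).
by apply: eq_bigr => x _; rewrite mulrBl.
Qed.

Lemma parseval f : l2norm_sq f = \sum_S fourier f S ^+ 2.
Proof.
rewrite /l2norm_sq.
transitivity (2 ^- d * \sum_x \sum_S fourier f S * (f x * walsh R S x)).
  congr (_ * _); apply: eq_bigr => x _.
  rewrite expr2 {2}fourier_inversion mulr_sumr.
  by apply: eq_bigr => S _; rewrite mulrCA.
rewrite exchange_big/= mulr_sumr; apply: eq_bigr => S _.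
by rewrite -mulr_sumr mulrCA -expr2.
Qed.

(** With [D = k + 1] this bounds the bias of a projection of degree [k]; with
    [D = 1] it bounds the whole norm. *)
Lemma ellipsoid_tail (B : R) f D : sobolev_ellipsoid d B f ->
  \sum_(S : {set 'I_d} | (D <= #|S|)%N) D%:R * fourier f S ^+ 2 <= B / 4.
Proof.
move=> [f0 fB]; rewrite ler_pdivlMr// mulrC; apply: le_trans fB.
rewrite ler_pM2l// big_mkcond [leRHS]big_mkcond/=; apply: ler_sum => S _.
have [->|S0] := eqVneq S finset.set0.
  by rewrite f0 expr0n/= mulr0 if_same.
case: ifP => [DS|_]; last by rewrite mulr_ge0 ?sqr_ge0.
by rewrite ler_wpM2r ?sqr_ge0// ler_nat.
Qed.

Lemma ellipsoid_l2norm_sq (B : R) f : sobolev_ellipsoid d B f ->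
  l2norm_sq f <= B / 4.
Proof.
move=> fB; apply: le_trans (ellipsoid_tail 1 fB); rewrite parseval.
case: fB => f0 _; rewrite big_mkcond/= [leRHS]big_mkcond/=.
apply: ler_sum => S _; rewrite mul1r; case: ifP => //.
by rewrite card_gt0 => /negbFE/eqP ->; rewrite f0 expr0n.
Qed.

End walsh_analysis.

(** * Integration on the cube and over independent samples *)

Section finite_cube.
Context (R : realType) (d : nat).

Lemma measurable_cube (A : set (cube d)) : measurable A.
Proof.
have m1 x : measurable [set x : cube d].
  have -> : [set x] = \bigcap_(i in [set: 'I_d])
      ((fun z : cube d => tnth z i) @^-1` [set tnth x i]).
    apply/seteqP; split=> [z -> //|z h]; apply: eq_from_tnth => i.
    exact: (h i).
  apply: fin_bigcap_measurable => // i _.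
  by rewrite -[X in measurable X]setTI; apply: measurable_tnth.
have -> : A = \bigcup_(x in A) [set x].
  by apply/seteqP; split=> [z Az|z [x Ax ->]//]; exists z.
by apply: fin_bigcup_measurable => //; exact: finite_finset.
Qed.

Lemma measurable_fun_cube d' (T : measurableType d') (f : cube d -> T) :
  measurable_fun [set: cube d] f.
Proof. by move=> _ A _; exact: measurable_cube. Qed.

Lemma ge0_integral_cube (F : cube d -> \bar R) : (forall x, 0 <= F x)%E ->
  (\int[cube_law R d]_x F x = (2 ^- d)%:E * \sum_(x : cube d) F x)%E.
Proof.
move=> F0; have mF : measurable_fun [set: cube d] F.
  exact: measurable_fun_cube.
rewrite /cube_law ge0_integral_mscale//= ge0_integral_measure_sum//=.
congr (_ * _)%E.
under eq_bigr do rewrite integral_dirac// diracT mul1e.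
rewrite cardE -(big_mkord xpredT (fun k =>
  F (nth (nseq_tuple d false) (enum {: cube d}) k))).
by rewrite -(big_nth _ xpredT F) big_enum.
Qed.

End finite_cube.

Section iid_integrals.
Context (dsp : measure_display) (T : measurableType dsp) (R : realType).
Variable P : probability T R.
Local Open Scope ereal_scope.

Lemma ge0_integral_iid0 (F : 0.-tuple T -> \bar R) :
  measurable_fun setT F -> \int[iid_power P 0]_z F z = F [tuple].
Proof. by move=> mF; rewrite /= integral_dirac// diracT mul1e. Qed.

Lemma ge0_integral_iidS n (F : n.+1.-tuple T -> \bar R) :
  measurable_fun setT F -> (forall z, 0 <= F z) ->
  \int[iid_power P n.+1]_z F z =
  \int[P]_x \int[iid_power P n]_z F (Defs.cons_tuple (x, z)).
Proof.
move=> mF F0; rewrite /= ge0_integral_distribution//.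
rewrite (fubini_tonelli1 (F \o @Defs.cons_tuple _ T n))//.
  by apply: measurableT_comp => //; exact: measurable_cons_tuple.
by move=> z /=; exact: F0.
Qed.

Lemma measurable_cons_tupler n (x : T) :
  measurable_fun [set: n.-tuple T]
    (fun z : n.-tuple T => Defs.cons_tuple (x, z)).
Proof. by apply: (measurable_cons (f := fun=> x) (g := id)). Qed.

Lemma measurable_sum_tnth n (g : T -> R) : measurable_fun setT g ->
  measurable_fun [set: n.-tuple T]
    (fun z : n.-tuple T => \sum_(j < n) g (tnth z j))%R.
Proof.
move=> mg; apply: measurable_sum => j.
by apply: measurableT_comp => //; exact: measurable_tnth.
Qed.

Lemma measurable_prod_tnth n (g : T -> R) : measurable_fun setT g ->
  measurable_fun [set: n.-tuple T]
    (fun z : n.-tuple T => \prod_(j < n) g (tnth z j))%R.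
Proof.
move=> mg; apply: measurable_prod => j _.
by apply: measurableT_comp => //; exact: measurable_tnth.
Qed.

(** The hypothesis says that [g] is centered with variance [v]. In this form
    the cross terms never show up as integrals of signed functions on the
    product space, and only Tonelli's theorem is needed. *)
Lemma iid_sum_sqr (g : T -> R) (v : R) : measurable_fun setT g -> (0 <= v)%R ->
  (forall c : R, \int[P]_x ((g x + c) ^+ 2)%:E = (c ^+ 2 + v)%:E) ->
  forall n (c : R),
  \int[iid_power P n]_z ((\sum_(j < n) g (tnth z j) + c) ^+ 2)%:E =
  (c ^+ 2 + n%:R * v)%:E.
Proof.
move=> mg v0 gv; have m n c : measurable_fun setT
    (fun z : n.-tuple T => ((\sum_(j < n) g (tnth z j) + c) ^+ 2)%:E).
  apply/measurable_EFinP; apply: measurable_funX; apply: measurable_funD => //.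
  exact: measurable_sum_tnth.
elim=> [|n IH] c.
  by rewrite ge0_integral_iid0// big_ord0 add0r mul0r addr0.
rewrite ge0_integral_iidS//; last by move=> z; rewrite lee_fin sqr_ge0.
transitivity (\int[P]_x (((g x + c) ^+ 2)%:E + (n%:R * v)%:E)).
  apply: eq_integral => x _; rewrite -EFinD -IH; apply: eq_integral => z _.
  rewrite big_ord_recl/= {1}/Defs.cons_tuple tnth0/=.
  under eq_bigr do rewrite /Defs.cons_tuple/= tnthS.
  by congr (_ ^+ 2)%:E; ring.
rewrite ge0_integralD//; last 3 first.
- by move=> x _; rewrite lee_fin sqr_ge0.
- by apply/measurable_EFinP; apply: measurable_funX; exact: measurable_funD.
- by move=> x _; rewrite lee_fin mulr_ge0.
rewrite gv integral_cst// [X in _ * X]probability_setT mule1 -EFinD.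
by congr _%:E; rewrite -natr1; ring.
Qed.

Lemma measurable_map_tuple n (phi : T -> T) : measurable_fun setT phi ->
  measurable_fun [set: n.-tuple T]
    (fun z : n.-tuple T => [tuple of map phi z]).
Proof.
move=> mphi; apply/measurable_fun_tnthP => i /=.
rewrite (_ : _ \o _ = phi \o (fun z => tnth z i)); last first.
  by apply/funext => z /=; rewrite tnth_map.
by apply: measurableT_comp => //; exact: measurable_tnth.
Qed.

(** Change of measure for independent samples: densities multiply. *)
Lemma iid_change_of_measure (phi : T -> T) (l : T -> R) :
    measurable_fun setT phi -> measurable_fun setT l ->
    (forall x, 0 <= l x)%R ->
    (forall F : T -> \bar R, measurable_fun setT F -> (forall x, 0 <= F x) ->
      \int[P]_x F (phi x) = \int[P]_x (F x * (l x)%:E)) ->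
  forall n (F : n.-tuple T -> \bar R),
    measurable_fun setT F -> (forall z, 0 <= F z) ->
  \int[iid_power P n]_z F [tuple of map phi z] =
  \int[iid_power P n]_z (F z * (\prod_(j < n) l (tnth z j))%:E).
Proof.
move=> mphi ml l0 philP.
have mmap n := @measurable_map_tuple n phi mphi.
have prod0 n (z : n.-tuple T) : 0 <= (\prod_(j < n) l (tnth z j))%:E.
  by rewrite lee_fin; apply: prodr_ge0.
have mFl n (F : n.-tuple T -> \bar R) : measurable_fun setT F ->
    measurable_fun setT (fun z => F z * (\prod_(j < n) l (tnth z j))%:E).
  move=> mF; apply: emeasurable_funM => //.
  by apply/measurable_EFinP; exact: measurable_prod_tnth.
elim=> [|n IH] F mF F0.
  rewrite !ge0_integral_iid0//; [|exact: mFl|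
    exact: (measurableT_comp mF (mmap _))].
  by rewrite big_ord0 mule1; congr F; exact: val_inj.
rewrite ge0_integral_iidS; [|exact: (measurableT_comp mF (mmap _))|by []].
rewrite ge0_integral_iidS; [|exact: mFl|by move=> z; exact: mule_ge0].
pose G x := \int[iid_power P n]_z
  (F (Defs.cons_tuple (x, z)) * (\prod_(j < n) l (tnth z j))%:E).
transitivity (\int[P]_x G (phi x)).
  apply: eq_integral => x _; rewrite /G.
  rewrite -(IH (fun z => F (Defs.cons_tuple (phi x, z)))) => //; last first.
    by apply: measurableT_comp => //; exact: measurable_cons_tupler.
  by apply: eq_integral => z _; congr F; exact: val_inj.
have mH : measurable_fun setT (fun xz : T * n.-tuple T =>
    F (Defs.cons_tuple xz) * (\prod_(j < n) l (tnth xz.2 j))%:E).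
  apply: emeasurable_funM.
    by apply: measurableT_comp => //; exact: measurable_cons_tuple.
  apply/measurable_EFinP.
  by apply: (measurableT_comp (measurable_prod_tnth ml)).
have mG : measurable_fun setT G.
  apply: (measurable_fun_fubini_tonelli_F _ mH) => xz.
  exact: mule_ge0.
rewrite philP//; last by move=> x; apply: integral_ge0 => z _; rewrite mule_ge0.
apply: eq_integral => x _; rewrite /G -ge0_integralZr//; first last.
- by rewrite lee_fin.
- by move=> z _; rewrite mule_ge0.
- apply: mFl; apply: measurableT_comp => //; exact: measurable_cons_tupler.
apply: eq_integral => z _; rewrite -muleA; congr (_ * _).
rewrite -EFinM big_ord_recl/= {1}/Defs.cons_tuple tnth0/= mulrC; congr (_ * _)%:E.
by apply: eq_bigr => j _; rewrite /Defs.cons_tuple tnthS.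
Qed.

End iid_integrals.

(** * Sub-Gaussian and Gaussian noise *)

Section normal_shift.
Context (R : realType).
Local Open Scope ereal_scope.
Notation mu := (@lebesgue_measure R).

(** Lebesgue measure is determined by its values on half-open intervals, so it
    is translation invariant. *)
Lemma lebesgue_measure_shift (m : R) (A : set R) : measurable A ->
  pushforward mu
    (fun x : measurableTypeR R => x + m : measurableTypeR R)%R A = mu A.
Proof.
move=> mA.
pose phi (x : measurableTypeR R) : measurableTypeR R := (x + m)%R.
have mphi : measurable_fun setT phi by exact: measurable_funD.
pose phi_mixin := isMeasurableFun.Build _ _ _ _ _ mphi.
pose phi_mfun : {mfun measurableTypeR R >-> measurableTypeR R} :=
  HB.pack phi phi_mixin.
rewrite -[LHS]/(pushforward mu phi_mfun A).
apply/esym/lebesgue_measure_unique => //= _ [[a b]] _ <-.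
rewrite /pushforward.
have -> : phi @^-1` `]a, b]%classic = `](a - m)%R, (b - m)%R]%classic.
  by apply/seteqP; split=> x /=; rewrite !in_itv/= ltrBlDr lerBrDr.
by rewrite !lebesgue_measure_itv/= !lte_fin ltrD2r -!EFinD; case: ifP => // _;
  congr _%:E; ring.
Qed.

Lemma ge0_integral_shift (m : R) (F : R -> \bar R) :
  measurable_fun [set: R] F -> (forall x, 0 <= F x) ->
  \int[mu]_x F (x + m)%R = \int[mu]_x F x.
Proof.
move=> mF F0.
have ms : measurable_fun setT
    (fun x : measurableTypeR R => x + m : measurableTypeR R)%R.
  exact: measurable_funD.
transitivity (\int[pushforward mu (fun x : measurableTypeR R =>
    x + m : measurableTypeR R)%R]_x F x).
  by rewrite ge0_integral_pushforward.
by apply: eq_measure_integral => A mA _; exact: lebesgue_measure_shift.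
Qed.

(** [normal_pdf] agrees almost everywhere with the Radon-Nikodym derivative of
    [normal_prob], as both have the same integral over every measurable set. *)
Lemma ge0_integral_normal_prob (m s : R) (F : R -> \bar R) :
  measurable_fun [set: R] F -> (forall x, 0 <= F x) ->
  \int[normal_prob m s]_x F x = \int[mu]_x (F x * (normal_pdf m s x)%:E).
Proof.
move=> mF F0; have dom := normal_prob_dominates m s.
rewrite -(Radon_Nikodym_SigmaFinite.change_of_variables dom F0)//.
have mpdf : measurable_fun [set: R] (fun x => (normal_pdf m s x)%:E).
  by apply/measurable_EFinP; exact: measurable_normal_pdf.
have iRN := Radon_Nikodym_SigmaFinite.f_integrable dom.
apply: ge0_ae_eq_integral => //.
- by apply: emeasurable_funM => //; exact: measurable_int iRN.
- exact: emeasurable_funM.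
- by move=> x _; rewrite mule_ge0//; exact: Radon_Nikodym_SigmaFinite.f_ge0.
- by move=> x _; rewrite mule_ge0// lee_fin normal_pdf_ge0.
apply: ae_eqe_mul2l; apply: integral_ae_eq => // E _ mE.
by rewrite -Radon_Nikodym_SigmaFinite.f_integral.
Qed.

(** The density of [N(m, s^2)] with respect to [N(0, s^2)]. *)
Definition normal_tilt (s m x : R) : R := expR ((x * m - m ^+ 2 / 2) / s ^+ 2).

Lemma normal_pdf_tilt (s m x : R) : s != 0%R ->
  normal_pdf m s x = (normal_tilt s m x * normal_pdf 0 s x)%R.
Proof.
move=> s0; rewrite !normal_pdfE// mulrCA; congr (_ * _)%R.
by rewrite /normal_fun /normal_tilt -expRD; congr expR; field.
Qed.

Lemma measurable_normal_tilt (s m : R) :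
  measurable_fun [set: R] (normal_tilt s m).
Proof.
apply: measurableT_comp => //; apply: measurable_funM => //.
by apply: measurable_funB => //; exact: measurable_funM.
Qed.

Lemma normal_shift (s m : R) (F : R -> \bar R) : s != 0%R ->
  measurable_fun [set: R] F -> (forall x, 0 <= F x) ->
  \int[normal_prob 0 s]_x F (m + x)%R =
  \int[normal_prob 0 s]_x (F x * (normal_tilt s m x)%:E).
Proof.
move=> s0 mF F0.
have mt : measurable_fun [set: R] (fun x => (normal_tilt s m x)%:E).
  by apply/measurable_EFinP; exact: measurable_normal_tilt.
have mp : measurable_fun [set: R] (fun x => (normal_pdf m s x)%:E).
  by apply/measurable_EFinP; exact: measurable_normal_pdf.
rewrite !ge0_integral_normal_prob//; first last.
- by apply: measurableT_comp => //; exact: measurable_funD.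
- by move=> x; rewrite mule_ge0// lee_fin expR_ge0.
- exact: emeasurable_funM.
rewrite -[LHS]/(\int[mu]_x (F (m + x)%R * (normal_pdf 0 s x)%:E)).
transitivity (\int[mu]_x (F x * (normal_pdf m s x)%:E)).
  rewrite -(@ge0_integral_shift m (fun x => F x * (normal_pdf m s x)%:E)).
  - apply: eq_integral => x _; rewrite addrC; congr (_ * _%:E).
    by rewrite !normal_pdfE// /normal_fun addrK subr0.
  - exact: emeasurable_funM.
  - by move=> x; rewrite mule_ge0// lee_fin normal_pdf_ge0.
by apply: eq_integral => x _; rewrite normal_pdf_tilt// EFinM muleA.
Qed.

(** Completing the square: the exponential tilt of a Gaussian density is a
    constant times the Gaussian density of mean [s ^ 2 * t], of integral 1. *)
Lemma normal_mgf (s t : R) : s != 0%R ->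
  \int[normal_prob 0 s]_x (expR (t * x))%:E = (expR (s ^+ 2 * t ^+ 2 / 2))%:E.
Proof.
move=> s0; rewrite ge0_integral_normal_prob; first last.
- by move=> x; rewrite lee_fin expR_ge0.
- by apply/measurable_EFinP; apply: measurableT_comp => //; exact: measurable_funM.
rewrite -[LHS]/(\int[mu]_x ((expR (t * x))%:E * (normal_pdf 0 s x)%:E)).
transitivity (\int[mu]_x ((expR (s ^+ 2 * t ^+ 2 / 2))%:E *
    (normal_pdf (s ^+ 2 * t) s x)%:E)).
  apply: eq_integral => x _.
  rewrite (@normal_pdf_tilt s (s ^+ 2 * t))// -!EFinM mulrA.
  by rewrite /normal_tilt -expRD; congr (expR _ * _)%:E; field.
rewrite ge0_integralZl//; first by rewrite integral_normal_pdf mule1.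
- by apply/measurable_EFinP; exact: measurable_normal_pdf.
- by move=> x _; rewrite lee_fin normal_pdf_ge0.
Qed.

End normal_shift.

Section sub_gaussian.
Context (R : realType).
Local Open Scope ereal_scope.
Implicit Type P : probability R R.

Lemma mmt_gen_funE P t :
  'M_P (fun e : R => e) t = \int[P]_e (expR (t * e))%:E.
Proof.
rewrite /mmt_gen_fun unlock; apply: eq_integral => e _.
by rewrite /= mulrC.
Qed.

Lemma measurable_expR_scale (t : R) :
  measurable_fun [set: R] (fun e => (expR (t * e))%:E).
Proof.
by apply/measurable_EFinP; apply: measurableT_comp => //; exact: measurable_funM.
Qed.

Lemma sqr_le_expR_sym (u : R) : (u ^+ 2 / 2 <= expR u + expR (- u))%R.
Proof.
wlog u0 : u / (0 <= u)%R => [hw|].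
  have [u0|u0] := leP 0%R u; first exact: hw.
  have := hw (- u)%R; rewrite sqrrN opprK addrC; apply.
  by rewrite oppr_ge0 ltW.
have := expR_ge1Dxn 1 u0; have := expR_gt0 (- u).
rewrite (_ : 2`! = 2)%N//; lra.
Qed.

Lemma expR_half_le2 : (expR (1 / 2) <= 2 :> R)%R.
Proof.
have h : (1 / 2 <= expR (- (1 / 2)) :> R)%R by have := expR_ge1Dx (- (1 / 2) : R); lra.
have p := expR_gt0 (1 / 2 : R).
have e := expRxMexpNx_1 (1 / 2 : R); nra.
Qed.

(** The bound is not sharp: the variance is at most [s2]. A constant factor
    is harmless, and this one follows from the moment generating function at
    the two points [+- s2 ^ (- 1/2)]. *)
Lemma sub_gaussian_second_moment P (s2 : R) :
  (0 < s2)%R -> sub_gaussian_noise s2 P ->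
  \int[P]_e (e ^+ 2)%:E <= (8 * s2)%:E.
Proof.
move=> s20 [_ [_ Pm]].
pose t : R := ((Num.sqrt s2)^-1)%R.
have t2 : (s2 * t ^+ 2 = 1)%R.
  by rewrite exprVn sqr_sqrtr ?ltW// mulfV// gt_eqF.
have M u : (u ^+ 2 = t ^+ 2)%R -> \int[P]_e (expR (u * e))%:E <= 2%:E.
  move=> ut; rewrite -mmt_gen_funE (le_trans (Pm u))// lee_fin ut t2.
  exact: expR_half_le2.
apply: (@le_trans _ _ (\int[P]_e ((2 * s2)%:E *
    ((expR (t * e))%:E + (expR ((- t) * e))%:E)))).
  apply: ge0_le_integral => //.
  - by move=> e _; rewrite lee_fin sqr_ge0.
  - by apply/measurable_EFinP; exact: measurable_funX.
  - apply: measurable_funeM; apply: emeasurable_funD;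
      exact: measurable_expR_scale.
  - move=> e _; rewrite -EFinD -EFinM lee_fin.
    have := sqr_le_expR_sym (t * e); rewrite exprMn mulNr.
    set A := (_ + _)%R => h.
    have -> : (e ^+ 2 = 2 * s2 * (t ^+ 2 * e ^+ 2 / 2))%R.
      by transitivity (s2 * t ^+ 2 * e ^+ 2)%R; [rewrite t2 mul1r|field].
    by rewrite ler_pM2l// mulr_gt0.
rewrite ge0_integralZl//; first last.
- by rewrite lee_fin mulr_ge0// ltW.
- by move=> e _; rewrite -EFinD lee_fin addr_ge0 ?expR_ge0.
- by apply: emeasurable_funD; exact: measurable_expR_scale.
rewrite ge0_integralD//; [|exact: measurable_expR_scale..].
apply: (@le_trans _ _ ((2 * s2)%:E * (2%:E + 2%:E))).
  rewrite lee_pmul2l ?lte_fin ?mulr_gt0//.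
  by apply: leeD; apply: M; rewrite ?sqrrN.
by rewrite -EFinD -EFinM lee_fin; lra.
Qed.

(** This gives the conditional second moment of an observation given the
    design point: the noise is multiplied by a sign [w], which leaves its
    variance unchanged. *)
Lemma sub_gaussian_affine_sqr P (s2 : R) :
  (0 < s2)%R -> sub_gaussian_noise s2 P ->
  exists2 v : R, (0 <= v <= 8 * s2)%R & forall b w : R, (w ^+ 2 = 1)%R ->
  \int[P]_e ((b + w * e) ^+ 2)%:E = (b ^+ 2 + v)%:E.
Proof.
move=> s20 Ps; have h2 := sub_gaussian_second_moment s20 Ps.
have [Pi [P0 _]] := Ps.
have i0 : 0 <= \int[P]_e (e ^+ 2)%:E.
  by apply: integral_ge0 => e _; rewrite lee_fin sqr_ge0.
have fin2 : \int[P]_e (e ^+ 2)%:E \is a fin_num.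
  by rewrite ge0_fin_numE// (le_lt_trans h2)// ltry.
exists (fine (\int[P]_e (e ^+ 2)%:E)).
  by rewrite -!lee_fin fineK// i0.
move=> b w w1.
have int2 : P.-integrable setT (fun e : R => (e ^+ 2)%:E).
  apply/integrableP; split; first by apply/measurable_EFinP; exact: measurable_funX.
  under eq_integral do rewrite gee0_abs ?lee_fin ?sqr_ge0//.
  by rewrite (le_lt_trans h2)// ltry.
have intc : P.-integrable setT (fun e : R => (b ^+ 2)%:E).
  exact: finite_measure_integrable_cst.
have int1 : P.-integrable setT (fun e : R => (2 * b * w)%:E * e%:E).
  exact: integrableZl.
transitivity (\int[P]_e (((b ^+ 2)%:E + (2 * b * w)%:E * e%:E) + (e ^+ 2)%:E)).
  apply: eq_integral => e _; rewrite -EFinM -!EFinD; congr _%:E.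
  transitivity (b ^+ 2 + 2 * b * w * e + w ^+ 2 * e ^+ 2)%R; first by ring.
  by rewrite w1 mul1r.
rewrite integralD//; last exact: integrableD.
rewrite integralD// integral_cst// [X in _ * X]probability_setT mule1.
rewrite integralZl//; move: P0; rewrite unlock => ->.
by rewrite mule0 adde0 EFinD fineK.
Qed.

(** From [1 + t * e <= expR (t * e)], the mean [m] satisfies
    [1 + t * m <= expR (s2 * t ^ 2 / 2)] for all [t]. The right-hand side is
    [1 + O(t ^ 2)], so letting [t] tend to 0 from both sides forces [m = 0]. *)
Lemma sub_gaussian_mean0 P (s2 : R) : (0 < s2)%R ->
    P.-integrable setT (fun e : R => e%:E) ->
    (forall t, \int[P]_e (expR (t * e))%:E <= (expR (s2 * t ^+ 2 / 2))%:E) ->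
  \int[P]_e e%:E = 0.
Proof.
move=> s20 Pi Pm.
have fm := integrable_fin_num measurableT Pi.
rewrite -(fineK fm); congr _%:E; set m := fine _.
have tm t : (1 + t * m <= expR (s2 * t ^+ 2 / 2))%R.
  rewrite -lee_fin; apply: le_trans (Pm t).
  have ie : P.-integrable setT (fun e : R => (expR (t * e))%:E).
    apply/integrableP; split; first exact: measurable_expR_scale.
    under eq_integral do rewrite gee0_abs ?lee_fin ?expR_ge0//.
    by rewrite (le_lt_trans (Pm t))// ltry.
  have intc : P.-integrable setT (fun e : R => 1%:E).
    exact: finite_measure_integrable_cst.
  have int1 : P.-integrable setT (fun e : R => t%:E * e%:E).
    exact: integrableZl.
  have -> : (1 + t * m)%:E = \int[P]_e (1%:E + t%:E * e%:E).
    rewrite integralD// integral_cst// [X in _ * X]probability_setT mule1.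
    by rewrite integralZl// -(fineK fm) -EFinM -EFinD.
  apply: le_integral => //; first exact: integrableD.
  by move=> e _; rewrite -EFinM -EFinD lee_fin expR_ge1Dx.
have quad t : (s2 * t ^+ 2 <= 1 -> t * m <= s2 * t ^+ 2)%R.
  move=> t1; set u := (s2 * t ^+ 2)%R in t1 *.
  have u0 : (0 <= u)%R by rewrite mulr_ge0 ?sqr_ge0// ltW.
  have h : (1 - u / 2 <= expR (- (u / 2)))%R by exact: expR_ge1Dx.
  have p := expR_gt0 (u / 2); have e := expRxMexpNx_1 (u / 2).
  have := tm t; rewrite -/u => tmu.
  have : (expR (u / 2) <= 1 + u)%R by nra.
  by move: tmu; lra.
apply/eqP; rewrite -normr_le0; apply/ler_addgt0Pr => eps eps0; rewrite add0r.
(* [t] is small enough for [quad] at [+- t], and [s2 * t <= eps]. *)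
pose t : R := (Num.min (eps / s2) (Num.min 1 s2^-1))%R.
have t0 : (0 < t)%R by rewrite !lt_min divr_gt0//= ltr01/= invr_gt0.
have t1 : (t <= 1)%R by rewrite !ge_min lexx !orbT.
have t2 : (s2 * t <= 1)%R.
  by rewrite mulrC -ler_pdivlMr// div1r !ge_min lexx !orbT.
have t3 : (s2 * t <= eps)%R by rewrite mulrC -ler_pdivlMr// !ge_min lexx.
have t4 : (s2 * t ^+ 2 <= 1)%R by rewrite expr2; nra.
have q1 := quad t t4; have := quad (- t)%R; rewrite sqrrN => /(_ t4) q2.
rewrite ler_norml; apply/andP; split.
  by rewrite -(ler_pM2l t0); nra.
by rewrite -(ler_pM2l t0); nra.
Qed.

End sub_gaussian.

Section gaussian_noise.
Context (R : realType).
Local Open Scope ereal_scope.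

Definition borel_id (x : measurableTypeR R) : R := x.

Let measurable_borel_id : measurable_fun setT borel_id.
Proof. by move=> _ A mA; rewrite setTI. Qed.

HB.instance Definition _ :=
  isMeasurableFun.Build _ _ _ _ borel_id measurable_borel_id.

(** The same law as [normal_prob 0 s]. The two carry the Borel sigma-algebra
    under different displays, hence the push-forward by the identity. *)
Definition gaussian_noise (s : R) : probability R R :=
  distribution (normal_prob 0 s) borel_id.

Lemma ge0_integral_gaussian (s : R) (F : R -> \bar R) :
  measurable_fun [set: R] F -> (forall x, 0 <= F x) ->
  \int[gaussian_noise s]_x F x = \int[normal_prob 0 s]_x F x.
Proof. by move=> mF F0; rewrite ge0_integral_distribution. Qed.

Lemma gaussian_shift (s m : R) (F : R -> \bar R) : s != 0%R ->
  measurable_fun [set: R] F -> (forall x, 0 <= F x) ->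
  \int[gaussian_noise s]_x F (m + x)%R =
  \int[gaussian_noise s]_x (F x * (normal_tilt s m x)%:E).
Proof.
move=> s0 mF F0; rewrite !ge0_integral_gaussian//.
- exact: normal_shift.
- apply: emeasurable_funM => //.
  by apply/measurable_EFinP; exact: measurable_normal_tilt.
- by move=> x; rewrite mule_ge0// lee_fin expR_ge0.
- by apply: measurableT_comp => //; exact: measurable_funD.
Qed.

Lemma gaussian_sub_gaussian (s : R) : s != 0%R ->
  sub_gaussian_noise (s ^+ 2) (gaussian_noise s).
Proof.
move=> s0; set P := gaussian_noise s.
have s20 : (0 < s ^+ 2)%R by rewrite exprn_even_gt0.
have mgf t : \int[P]_e (expR (t * e))%:E = (expR (s ^+ 2 * t ^+ 2 / 2))%:E.
  rewrite ge0_integral_gaussian; first exact: normal_mgf.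
    exact: measurable_expR_scale.
  by move=> e; rewrite lee_fin expR_ge0.
have imgf t : P.-integrable setT (fun e : R => (expR (t * e))%:E).
  apply/integrableP; split; first exact: measurable_expR_scale.
  under eq_integral do rewrite gee0_abs ?lee_fin ?expR_ge0//.
  by rewrite mgf ltry.
have Pi : P.-integrable setT (fun e : R => e%:E).
  apply: (@le_integrable _ _ _ P _ measurableT _
      (fun e => (expR (1 * e))%:E + (expR (- 1 * e))%:E)).
  - exact/measurable_EFinP.
  - move=> e _; rewrite -EFinD /= lee_fin [leRHS]ger0_norm; last first.
      by rewrite addr_ge0 ?expR_ge0.
    rewrite mul1r mulN1r ler_norml.
    have := expR_ge1Dx e; have := expR_ge1Dx (- e).
    have := expR_gt0 e; have := expR_gt0 (- e).
    by move=> *; apply/andP; split; lra.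
  - by apply: integrableD => //; exact: imgf.
split=> //; split.
  rewrite unlock; apply: (sub_gaussian_mean0 s20) => // t.
  by rewrite mgf.
by move=> t; rewrite mmt_gen_funE mgf.
Qed.

End gaussian_noise.

(** * Risk of the empirical projection *)

Section design.
Context (R : realType) (d : nat).

(** The cube is finite and discrete, so joint measurability is measurability
    of each section. *)
Lemma measurable_fun_cube_prod d1 d2 (T1 : measurableType d1)
    (T2 : measurableType d2) (g : cube d * T1 -> T2) :
  (forall x, measurable_fun [set: T1] (fun e => g (x, e))) ->
  measurable_fun [set: cube d * T1] g.
Proof.
move=> mg _ A mA; rewrite setTI.
have -> : g @^-1` A =
    \bigcup_(x in [set: cube d]) ([set x] `*` ((fun e => g (x, e)) @^-1` A)).
  apply/seteqP; split=> [[x e] Ag|[x e] [_ _ [/= -> //]]].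
  by exists x.
apply: fin_bigcup_measurable => [|x _]; first exact: finite_finset.
apply: measurableX; first exact: measurable_cube.
by rewrite -[X in measurable X]setTI; exact: mg.
Qed.

Lemma ge0_integral_design (P : probability R R) (F : cube d * R -> \bar R) :
  (forall x, measurable_fun [set: R] (fun e => F (x, e))) ->
  (forall z, 0 <= F z)%E ->
  (\int[cube_law R d \x P]_z F z =
   (2 ^- d)%:E * \sum_(x : cube d) \int[P]_e F (x, e))%E.
Proof.
move=> mF F0; rewrite fubini_tonelli1//; last exact: measurable_fun_cube_prod.
by rewrite ge0_integral_cube// => x; exact: integral_ge0.
Qed.

Definition observe (f : cube d -> R) (xe : cube d * R) : cube d * R :=
  (xe.1, f xe.1 + xe.2).

Lemma measurable_observe f : measurable_fun setT (observe f).
Proof.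
apply: measurable_fun_cube_prod => x /=.
have mxe : measurable_fun [set: R] (fun e => f x + e).
  exact: measurable_funD.
by apply/measurable_fun_pairP; split; [exact: measurable_cst|exact: mxe].
Qed.

Lemma measurable_sample_of n (f : cube d -> R) :
  measurable_fun setT (fun z : n.-tuple (cube d * R) => sample_of f z).
Proof. exact: (@measurable_map_tuple _ _ n _ (measurable_observe f)). Qed.

End design.

Section projection_risk.
Context (R : realType) (d n : nat).
Implicit Types (f : cube d -> R) (S : {set 'I_d}).

Lemma measurable_emp_fourier S :
  measurable_fun setT (fun s : n.-tuple (cube d * R) => emp_fourier s S).
Proof.
apply: measurable_funM => //.
apply: (@measurable_sum_tnth _ _ _ n
  (fun xy : cube d * R => xy.2 * walsh R S xy.1)).
by apply: measurable_fun_cube_prod => x /=; exact: measurable_funM.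
Qed.

Lemma emp_projection_estimator D : is_estimator (@emp_projection R d n D).
Proof.
move=> x; under eq_fun do rewrite /emp_projection big_mkcond/=.
apply: measurable_sum => S; case: (leqP #|S| D) => // _.
by apply: measurable_funM => //; exact: measurable_emp_fourier.
Qed.

Definition coeff_error f S (z : cube d * R) : R :=
  (f z.1 + z.2) * walsh R S z.1 - fourier f S.

Lemma measurable_coeff_error_noise f S x :
  measurable_fun [set: R] (fun e => coeff_error f S (x, e)).
Proof.
rewrite /coeff_error/=; apply: measurable_funB => //.
by apply: measurable_funM => //; exact: measurable_funD.
Qed.

Lemma measurable_coeff_error f S : measurable_fun setT (coeff_error f S).
Proof.
by apply: measurable_fun_cube_prod => x; exact: measurable_coeff_error_noise.
Qed.

Lemma emp_fourier_error f S (z : n.-tuple (cube d * R)) : (0 < n)%N ->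
  emp_fourier (sample_of f z) S - fourier f S =
  n%:R^-1 * (\sum_(j < n) coeff_error f S (tnth z j) + 0).
Proof.
move=> n0; rewrite addr0 /emp_fourier /coeff_error sumrB mulrBr; congr (_ - _).
  by congr (_ * _); apply: eq_bigr => j _; rewrite /sample_of tnth_map.
by rewrite sumr_const card_ord -(mulr_natl (fourier f S)) mulKf// pnatr_eq0 -lt0n.
Qed.

(** Since [walsh R S] has square 1, the average of [(f * walsh R S) ^ 2] is
    [l2norm_sq f], and the average of [f * walsh R S] is [fourier f S]. *)
Lemma mean_shifted_coeff f S (c : R) :
  2 ^- d * \sum_(x : cube d) (f x * walsh R S x - fourier f S + c) ^+ 2 =
  c ^+ 2 + (l2norm_sq f - fourier f S ^+ 2).
Proof.
set h := fourier f S.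
transitivity (2 ^- d * (\sum_(x : cube d) f x ^+ 2) +
  (2 * (c - h)) * (2 ^- d * \sum_(x : cube d) f x * walsh R S x) +
  2 ^- d * \sum_(x : cube d) (c - h) ^+ 2).
  rewrite !mulr_sumr -!big_split/=; apply: eq_bigr => x _.
  transitivity (2 ^- d * (f x ^+ 2 * walsh R S x ^+ 2) +
    2 * (c - h) * (2 ^- d * (f x * walsh R S x)) + 2 ^- d * (c - h) ^+ 2).
    by ring.
  by rewrite walsh_sqr mulr1.
rewrite -/(l2norm_sq f) -/(fourier f S) -/h.
rewrite sumr_const card_tuple card_bool -(mulr_natl ((c - h) ^+ 2)) natrX.
by rewrite [X in _ + X]mulrA mulVf ?expf_neq0// mul1r; ring.
Qed.

(** The per-observation error is centered, with variance [l2norm_sq f -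
    fourier f S ^ 2] from the design plus the noise variance, and independent
    errors add up in quadrature. *)
Lemma coeff_risk (P : probability R R) (s2 : R) f S : (0 < n)%N -> 0 < s2 ->
  sub_gaussian_noise s2 P ->
  (\int[design_noise_law d n P]_z
    ((emp_fourier (sample_of f z) S - fourier f S) ^+ 2)%:E
   <= ((l2norm_sq f + 8 * s2) / n%:R)%:E)%E.
Proof.
move=> n0 s20 Ps.
have [v /andP[v0 vs] vP] := sub_gaussian_affine_sqr s20 Ps.
have nR0 : 0 < n%:R :> R by rewrite ltr0n.
pose w := l2norm_sq f - fourier f S ^+ 2 + v.
have w0 : 0 <= w.
  have := mean_shifted_coeff f S 0; rewrite expr0n add0r /w => <-.
  rewrite addr_ge0// mulr_ge0 ?invr_ge0 ?exprn_ge0//.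
  by apply: sumr_ge0 => x _; exact: sqr_ge0.
have mg := measurable_coeff_error f S.
have gw c : (\int[cube_law R d \x P]_z ((coeff_error f S z + c) ^+ 2)%:E =
    (c ^+ 2 + w)%:E)%E.
  rewrite ge0_integral_design; first last.
  - by move=> z; rewrite lee_fin sqr_ge0.
  - move=> x; apply/measurable_EFinP; apply: measurable_funX.
    by apply: measurable_funD => //; exact: measurable_coeff_error_noise.
  under eq_bigr => x _.
    rewrite (_ : (\int[P]_e _)%E =
        ((f x * walsh R S x - fourier f S + c) ^+ 2 + v)%:E); last first.
      rewrite -(vP _ _ (walsh_sqr R S x)); apply: eq_integral => e _.
      by rewrite /coeff_error /=; congr (_ ^+ 2)%:E; ring.
    over.
  rewrite sumEFin -EFinM; congr _%:E.
  rewrite big_split/= mulrDr mean_shifted_coeff sumr_const card_tuple card_bool.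
  rewrite -(mulr_natl v) natrX [X in _ + X]mulrA mulVf ?expf_neq0// mul1r.
  by rewrite /w; ring.
under eq_integral do rewrite emp_fourier_error// exprMn EFinM.
rewrite ge0_integralZl//; first last.
- by move=> z _; rewrite lee_fin sqr_ge0.
- apply/measurable_EFinP; apply: measurable_funX; apply: measurable_funD => //.
  exact: measurable_sum_tnth.
rewrite (iid_sum_sqr mg w0 gw) -EFinM lee_fin expr0n add0r.
rewrite [leLHS](_ : _ = w / n%:R); last first.
  by field; rewrite gt_eqF.
by rewrite ler_pM2r ?invr_gt0// /w lerD// gerDl oppr_le0 sqr_ge0.
Qed.

Lemma card_le_sets D : #|[pred S : {set 'I_d} | (#|S| <= D)%N]| = Ndim d D.
Proof.
rewrite -sum1_card (partition_big (fun S => inord #|S| : 'I_D.+1) xpredT)//=.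
rewrite /Ndim big_mkord; apply: eq_bigr => k _.
have := card_draws 'I_d k; rewrite card_ord => <-.
rewrite -sum1_card; apply: eq_bigl => S; rewrite !inE.
have [SD|SD] := leqP #|S| D; first by rewrite -val_eqE/= inordK.
by apply/esym/negbTE; apply: contraTneq SD => ->; rewrite -leqNgt -ltnS.
Qed.

Lemma emp_projection_sq_error f D (s : n.-tuple (cube d * R)) :
  l2norm_sq (fun x => emp_projection D s x - f x) =
  \sum_(S : {set 'I_d} | (#|S| <= D)%N) (emp_fourier s S - fourier f S) ^+ 2 +
  \sum_(S : {set 'I_d} | (D < #|S|)%N) fourier f S ^+ 2.
Proof.
rewrite parseval (bigID (fun S : {set 'I_d} => (#|S| <= D)%N))/=; congr (_ + _).
  apply: eq_bigr => S SD; rewrite fourierB /emp_projection.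
  by rewrite (fourier_walsh_sum (fun S : {set 'I_d} => (#|S| <= D)%N)) SD.
rewrite (eq_bigl (fun S : {set 'I_d} => (D < #|S|)%N)); last first.
  by move=> S; rewrite -ltnNge.
apply: eq_bigr => S SD; rewrite fourierB /emp_projection.
rewrite (fourier_walsh_sum (fun S : {set 'I_d} => (#|S| <= D)%N)).
by rewrite leqNgt SD/= sub0r sqrrN.
Qed.

Lemma emp_projection_risk (P : probability R R) (s2 B : R) f D :
  (0 < n)%N -> 0 < s2 -> sub_gaussian_noise s2 P -> sobolev_ellipsoid d B f ->
  (risk P (@emp_projection R d n D) f <=
   ((Ndim d D)%:R * ((B / 4 + 8 * s2) / n%:R) + B / (4 * D.+1%:R))%:E)%E.
Proof.
move=> n0 s20 Ps fB; rewrite /risk unlock.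
pose bias := \sum_(S : {set 'I_d} | (D < #|S|)%N) fourier f S ^+ 2.
pose sq S (z : n.-tuple (cube d * R)) : \bar R :=
  ((emp_fourier (sample_of f z) S - fourier f S) ^+ 2)%:E.
have msq S : measurable_fun setT (sq S).
  apply/measurable_EFinP; apply: measurable_funX.
  under eq_fun do rewrite emp_fourier_error//.
  apply: measurable_funM => //; apply: measurable_funD => //.
  by apply: measurable_sum_tnth; exact: measurable_coeff_error.
have sq0 S z : (0 <= sq S z)%E by rewrite lee_fin sqr_ge0.
have bias0 : 0 <= bias by apply: sumr_ge0 => S _; exact: sqr_ge0.
have -> : (\int[design_noise_law d n P]_z
    (l2norm_sq (fun x => emp_projection D (sample_of f z) x - f x))%:E =
  \int[design_noise_law d n P]_z
    (\sum_(S <- enum [pred S : {set 'I_d} | (#|S| <= D)%N]) sq S z + bias%:E))%E.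
  apply: eq_integral => z _; rewrite emp_projection_sq_error EFinD.
  by rewrite -sumEFin big_enum/=.
rewrite ge0_integralD//; last 2 first.
- by move=> z _; exact: sume_ge0.
- by apply: emeasurable_sum => S.
rewrite integral_cst// [X in (_ * X)%E]probability_setT mule1 EFinD.
apply: leeD.
  rewrite ge0_integral_sum//.
  apply: (@le_trans _ _ (\sum_(S <- enum [pred S : {set 'I_d} | (#|S| <= D)%N])
      ((B / 4 + 8 * s2) / n%:R)%:E)%E).
    apply: lee_sum => S _; apply: le_trans (coeff_risk f S n0 s20 Ps) _.
    rewrite lee_fin ler_pM2r ?invr_gt0 ?ltr0n// lerD2r.
    exact: ellipsoid_l2norm_sq fB.
  rewrite sumEFin big_enum/= lee_fin.
  by rewrite sumr_const card_le_sets -[leLHS]mulr_natl.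
rewrite lee_fin invfM mulrA ler_pdivlMr// mulrC /bias mulr_sumr.
exact: ellipsoid_tail.
Qed.

End projection_risk.

(** * Comparison of two regression functions under Gaussian noise *)

Section two_points.
Context (R : realType) (d n : nat) (s : R).
Hypothesis s0 : s != 0.
Implicit Types f g : cube d -> R.

Let Q : probability (cube d * R)%type R := (cube_law R d \x gaussian_noise s)%E.
Let PQ := design_noise_law d n (gaussian_noise s).

Definition tilt f (z : cube d * R) : R := normal_tilt s (f z.1) z.2.

Lemma measurable_tilt f : measurable_fun setT (tilt f).
Proof.
apply: measurable_fun_cube_prod => x; rewrite /tilt/=.
exact: (measurable_normal_tilt s (f x)).
Qed.

Definition likelihood f (z : n.-tuple (cube d * R)) : R :=
  \prod_(j < n) tilt f (tnth z j).

Lemma likelihood_ge0 f z : 0 <= likelihood f z.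
Proof. by apply: prodr_ge0 => j _; exact: expR_ge0. Qed.

Lemma measurable_likelihood f : measurable_fun setT (likelihood f).
Proof. by apply: measurable_prod_tnth; exact: measurable_tilt. Qed.

(** Given the design, observing [f] amounts to shifting the Gaussian noise, so
    the law of the sample has density [likelihood f] with respect to the
    law of the pure design and noise. *)
Lemma sample_likelihood f (F : n.-tuple (cube d * R) -> \bar R) :
  measurable_fun setT F -> (forall z, 0 <= F z)%E ->
  (\int[PQ]_z F (sample_of f z) = \int[PQ]_z (F z * (likelihood f z)%:E))%E.
Proof.
apply: (@iid_change_of_measure _ _ _ Q (observe f) (tilt f)).
- exact: measurable_observe.
- exact: measurable_tilt.
- by move=> z; exact: expR_ge0.
move=> {}F mF F0.
have mFx x : measurable_fun [set: R] (fun e => F (x, e)).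
  by apply: measurableT_comp => //; exact: measurable_pair1.
have mtx x : measurable_fun [set: R] (fun e => (normal_tilt s (f x) e)%:E).
  by apply/measurable_EFinP; exact: measurable_normal_tilt.
rewrite [LHS]ge0_integral_design; first last.
- by move=> z; exact: F0.
- move=> x; rewrite /observe/=; apply: (measurableT_comp (mFx x)).
  exact: measurable_funD.
rewrite [RHS]ge0_integral_design; first last.
- by move=> z; rewrite mule_ge0// lee_fin expR_ge0.
- by move=> x; apply: emeasurable_funM; [exact: mFx|exact: mtx].
congr (_ * _)%E; apply: eq_bigr => x _ /=.
exact: (@gaussian_shift _ s (f x) (fun e => F (x, e))).
Qed.

Lemma integral_likelihood f : (\int[PQ]_z (likelihood f z)%:E = 1)%E.
Proof.
transitivity (\int[PQ]_z (cst 1 (sample_of f z)))%E.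
  rewrite sample_likelihood//.
  by apply: eq_integral => z _; rewrite mul1e.
by rewrite integral_cst// [X in (_ * X)%E]probability_setT mule1.
Qed.

(** Completing the square at each observation. As a likelihood integrates to 1,
    the integral of the geometric mean, the Hellinger affinity of the two
    samples, can be read off the constant factor. *)
Lemma likelihood_geometric_mean f g (b : R) z :
  (forall x, (f x - g x) ^+ 2 = 4 * b ^+ 2) ->
  exists p q : R, [/\ likelihood f z = p ^+ 2, likelihood g z = q ^+ 2 &
    p * q = expR (- (n%:R * (b ^+ 2 / (2 * s ^+ 2)))) *
      likelihood (fun x => (f x + g x) / 2) z].
Proof.
move=> fg; pose r h := \prod_(j < n)
  expR (((tnth z j).2 * h (tnth z j).1 - h (tnth z j).1 ^+ 2 / 2) / s ^+ 2 / 2).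
have rE h : likelihood h z = r h ^+ 2.
  rewrite /likelihood /r -prodrXl; apply: eq_bigr => j _.
  by rewrite expr2 -expRD; congr expR; field.
exists (r f), (r g); split => //.
rewrite -mulrN expRM_natl.
have -> e : expR e ^+ n = \prod_(j < n) expR e :> R.
  by rewrite prodr_const card_ord.
rewrite /r -!big_split/=.
apply: eq_bigr => j _; rewrite /tilt /normal_tilt -!expRD; congr expR.
move: (fg (tnth z j).1); set u := f _; set v := g _; set y := _.2 => uv.
have -> : b ^+ 2 = (u - v) ^+ 2 / 4 by rewrite uv; field.
by field.
Qed.

(** The left-hand side will be a multiple of a likelihood, so that no overlap
    integral remains to be computed. *)
Lemma two_point_ineq (p q b y : R) :
  4 * b ^+ 2 * (p * q) <=
  (y - b) ^+ 2 * p ^+ 2 + (y + b) ^+ 2 * q ^+ 2 + b ^+ 2 * (p ^+ 2 + q ^+ 2).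
Proof.
rewrite -subr_ge0.
have -> : (y - b) ^+ 2 * p ^+ 2 + (y + b) ^+ 2 * q ^+ 2 +
    b ^+ 2 * (p ^+ 2 + q ^+ 2) - 4 * b ^+ 2 * (p * q) =
  ((p + q) * y - 2 * b * (p - q)) ^+ 2 / 2 + ((p - q) * y) ^+ 2 / 2 by field.
by rewrite addr_ge0// divr_ge0// sqr_ge0.
Qed.

(** In the application, [u + b] and [u - b] are the values of one coefficient
    of [f] and [g]. Integrating [two_point_ineq] with the
    likelihoods [p ^ 2] and [q ^ 2] bounds the sum of the two risks below by
    [(4 A - 2) * b ^ 2], where the affinity [A] is at least 3/4 because
    [expR (- x) >= 1 - x]. *)
Lemma two_point_risk f g (b u : R) (t : n.-tuple (cube d * R) -> R) :
  measurable_fun setT t -> (forall x, (f x - g x) ^+ 2 = 4 * b ^+ 2) ->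
  n%:R * (b ^+ 2 / (2 * s ^+ 2)) <= 1 / 4 ->
  ((b ^+ 2)%:E <=
   \int[PQ]_z ((t (sample_of f z) - (u + b)) ^+ 2)%:E +
   \int[PQ]_z ((t (sample_of g z) - (u - b)) ^+ 2)%:E)%E.
Proof.
move=> mt fg nb.
have msq c : measurable_fun setT (fun z => ((t z - c) ^+ 2)%:E).
  apply/measurable_EFinP; apply: measurable_funX.
  exact: measurable_funB.
have sq0 c z : (0 <= ((t z - c) ^+ 2)%:E)%E by rewrite lee_fin sqr_ge0.
have L0 h z : (0 <= (likelihood h z)%:E)%E by rewrite lee_fin likelihood_ge0.
have mL h : measurable_fun setT (fun z => (likelihood h z)%:E).
  by apply/measurable_EFinP; exact: measurable_likelihood.
rewrite (@sample_likelihood f (fun z => ((t z - (u + b)) ^+ 2)%:E))//.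
rewrite (@sample_likelihood g (fun z => ((t z - (u - b)) ^+ 2)%:E))//.
set rf := (\int[PQ]_z _)%E; set rg := (\int[PQ]_z _)%E.
have rf0 : (0 <= rf)%E by apply: integral_ge0 => z _; exact: mule_ge0.
have rg0 : (0 <= rg)%E by apply: integral_ge0 => z _; exact: mule_ge0.
pose A := expR (- (n%:R * (b ^+ 2 / (2 * s ^+ 2)))).
have A34 : 3 / 4 <= A.
  by have := expR_ge1Dx (- (n%:R * (b ^+ 2 / (2 * s ^+ 2)))); rewrite -/A; lra.
have key : ((4 * b ^+ 2 * A)%:E <= (rf + rg) + (b ^+ 2 * 2)%:E)%E.
  pose h x := (f x + g x) / 2.
  have -> : (4 * b ^+ 2 * A)%:E =
      (\int[PQ]_z ((4 * b ^+ 2 * A)%:E * (likelihood h z)%:E))%E.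
    rewrite ge0_integralZl//; first by rewrite integral_likelihood mule1.
    by rewrite lee_fin mulr_ge0 ?expR_ge0// mulr_ge0// sqr_ge0.
  have -> : (b ^+ 2 * 2)%:E = (\int[PQ]_z ((b ^+ 2)%:E *
      ((likelihood f z)%:E + (likelihood g z)%:E)))%E.
    rewrite ge0_integralZl//; first last.
    - by rewrite lee_fin sqr_ge0.
    - by move=> z _; exact: adde_ge0.
    - exact: emeasurable_funD.
    by rewrite ge0_integralD// !integral_likelihood -EFinD -EFinM.
  rewrite /rf /rg -ge0_integralD//; first last.
  - exact: emeasurable_funM.
  - by move=> z _; exact: mule_ge0.
  - exact: emeasurable_funM.
  - by move=> z _; exact: mule_ge0.
  rewrite -ge0_integralD//; first last.
  - by apply: measurable_funeM; exact: emeasurable_funD.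
  - move=> z _; apply: mule_ge0; first by rewrite lee_fin sqr_ge0.
    exact: adde_ge0.
  - by apply: emeasurable_funD; exact: emeasurable_funM.
  - by move=> z _; apply: adde_ge0; exact: mule_ge0.
  apply: ge0_le_integral => //.
  - move=> z _; rewrite mule_ge0// lee_fin mulr_ge0 ?expR_ge0//.
    by rewrite mulr_ge0// sqr_ge0.
  - exact: measurable_funeM.
  - apply: emeasurable_funD.
      by apply: emeasurable_funD; exact: emeasurable_funM.
    by apply: measurable_funeM; exact: emeasurable_funD.
  move=> z _; rewrite -[((likelihood f z)%:E + _)%E]EFinD.
  rewrite -!EFinM -!EFinD lee_fin.
  have [p [q [-> -> pq]]] := likelihood_geometric_mean z fg.
  rewrite -/A -/h in pq; rewrite -[leLHS]mulrA -pq.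
  have := two_point_ineq p q b (t z - u).
  by rewrite !opprD opprK !addrA.
rewrite -(@leeD2rE _ (b ^+ 2 * 2)%:E)//; apply: le_trans key.
rewrite -EFinD lee_fin.
have := sqr_ge0 b; nra.
Qed.

End two_points.

(** * Assouad's lower bound over sign patterns *)

Section hypercube_lower_bound.
Context (R : realType) (d n k : nat).
Implicit Types (S T : {set 'I_d}).

Definition low_sets : pred {set 'I_d} :=
  [pred S : {set 'I_d} | (S != finset.set0) && (#|S| <= k)%N].

Lemma card_low_sets : #|low_sets|.+1 = Ndim d k.
Proof.
rewrite -(card_le_sets d k) [RHS](cardD1 (finset.set0 : {set 'I_d})).
by rewrite inE /= finset.cards0 add1n; congr _.+1.
Qed.

Notation vertex := {ffun {set 'I_d} -> bool}.

Definition vertex_fun (a : R) (th : vertex) (x : cube d) : R :=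
  \sum_(S | low_sets S) (a * (-1) ^+ th S) * walsh R S x.

Lemma fourier_vertex a th S :
  fourier (vertex_fun a th) S = if low_sets S then a * (-1) ^+ th S else 0.
Proof. exact: (fourier_walsh_sum low_sets). Qed.

Lemma vertex_ellipsoid (B a : R) th :
  4 * (k%:R * #|low_sets|%:R) * a ^+ 2 <= B ->
  sobolev_ellipsoid d B (vertex_fun a th).
Proof.
move=> aB; split.
  by rewrite fourier_vertex /low_sets /= eqxx.
apply: le_trans aB; rewrite /sobolev_energy -!mulrA ler_pM2l//.
apply: (@le_trans _ _ (\sum_(S | low_sets S) k%:R * a ^+ 2)).
  rewrite big_mkcond [leRHS]big_mkcond/=; apply: ler_sum => S _.
  rewrite fourier_vertex /low_sets /=; case: eqVneq => //= _.
  case: ifP => [Sk|_]; last by rewrite expr0n mulr0.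
  rewrite exprMn sqrr_sign mulr1.
  by rewrite ler_wpM2r ?sqr_ge0// ler_nat.
by rewrite sumr_const -[leLHS]mulr_natl mulrCA.
Qed.

Definition flip_vertex S (th : vertex) : vertex :=
  [ffun T => if T == S then ~~ th T else th T].

Lemma flip_vertexK S : involutive (flip_vertex S).
Proof.
by move=> th; apply/ffunP => T; rewrite !ffunE; case: eqP => // _; rewrite negbK.
Qed.

Lemma vertex_fun_flip a S th x : low_sets S ->
  vertex_fun a th x - vertex_fun a (flip_vertex S th) x =
  2 * (a * (-1) ^+ th S) * walsh R S x.
Proof.
move=> lS; rewrite /vertex_fun -sumrB (bigD1 S)//= big1 ?addr0.
  rewrite ffunE eqxx signrN mulrN mulNr opprK -mulrDl -mulr2n.
  by rewrite -(mulr_natl (a * _)).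
by move=> T /andP[_ TS]; rewrite ffunE (negbTE TS) subrr.
Qed.

Variables (s : R) (fh : n.-tuple (cube d * R) -> cube d -> R).
Hypotheses (s0 : s != 0) (fh_est : is_estimator fh).

Let PQ := design_noise_law d n (gaussian_noise s).

Definition coeff_loss (a : R) S (th : vertex) : \bar R :=
  (\int[PQ]_z ((fourier (fh (sample_of (vertex_fun a th) z)) S -
                fourier (vertex_fun a th) S) ^+ 2)%:E)%E.

Lemma measurable_estimated_coeff S :
  measurable_fun setT (fun z => fourier (fh z) S).
Proof.
apply: measurable_funM => //; apply: measurable_sum => x.
by apply: measurable_funM => //; exact: fh_est.
Qed.

Lemma coeff_loss_ge0 a S th : (0 <= coeff_loss a S th)%E.
Proof. by apply: integral_ge0 => z _; rewrite lee_fin sqr_ge0. Qed.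

(** Flipping the sign of [S] moves the function by [2 a] times a sign-valued
    function, hence by a constant absolute amount at every design point. *)
Lemma coeff_loss_flip a S th : low_sets S ->
  n%:R * (a ^+ 2 / (2 * s ^+ 2)) <= 1 / 4 ->
  ((a ^+ 2)%:E <= coeff_loss a S th + coeff_loss a S (flip_vertex S th))%E.
Proof.
move=> lS na; pose b := a * (-1) ^+ th S.
have b2 : b ^+ 2 = a ^+ 2 by rewrite exprMn sqrr_sign mulr1.
have fg x : (vertex_fun a th x - vertex_fun a (flip_vertex S th) x) ^+ 2 =
    4 * b ^+ 2.
  by rewrite vertex_fun_flip// -/b !exprMn walsh_sqr mulr1 -natrX.
rewrite -b2 in na *.
have := two_point_risk s0 0 (measurable_estimated_coeff S) fg na.
rewrite add0r sub0r /coeff_loss !fourier_vertex lS ffunE eqxx.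
by rewrite signrN mulrN.
Qed.

(** Parseval, dropping the coefficients that all the test functions share. *)
Lemma sum_coeff_loss_le_risk a th :
  (\sum_(S | low_sets S) coeff_loss a S th <=
   risk (gaussian_noise s) fh (vertex_fun a th))%E.
Proof.
have enumE (F : {set 'I_d} -> \bar R) :
  (\sum_(S | low_sets S) F S = \sum_(S <- enum low_sets) F S)%E.
  by rewrite big_enum.
rewrite /risk expectation.unlock -/PQ enumE.
have m S : measurable_fun setT (fun z =>
    ((fourier (fh (sample_of (vertex_fun a th) z)) S
      - fourier (vertex_fun a th) S) ^+ 2)%:E).
  apply/measurable_EFinP; apply: measurable_funX; apply: measurable_funB => //.
  apply: (measurableT_comp (measurable_estimated_coeff S)).
  exact: measurable_sample_of.
rewrite -ge0_integral_sum//=; last by move=> S z _; rewrite lee_fin sqr_ge0.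
apply: ge0_le_integral => //.
- by move=> z _; apply: sume_ge0 => S _; rewrite lee_fin sqr_ge0.
- exact: emeasurable_sum.
- apply/measurable_EFinP; under eq_fun do rewrite parseval.
  apply: measurable_sum => S; under eq_fun do rewrite fourierB.
  by apply/measurable_EFinP; exact: m.
move=> z _; rewrite -enumE sumEFin lee_fin parseval big_mkcond/=.
apply: ler_sum => S _; rewrite fourierB; case: ifP => // _; exact: sqr_ge0.
Qed.

(** Assouad's argument: average the risk over all sign patterns and pair
    each pattern with the one obtained by flipping a single sign. *)
Lemma assouad (a : R) (W : \bar R) :
  n%:R * (a ^+ 2 / (2 * s ^+ 2)) <= 1 / 4 ->
  (forall th, risk (gaussian_noise s) fh (vertex_fun a th) <= W)%E ->
  ((#|low_sets|%:R * a ^+ 2 / 2)%:E <= W)%E.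
Proof.
move=> na riskW; pose N := #|{: vertex}|.
have N0 : 0 < N%:R :> R by rewrite ltr0n; apply/card_gt0P; exists [ffun=> false].
have lossW th : (\sum_(S | low_sets S) coeff_loss a S th <= W)%E.
  exact: le_trans (sum_coeff_loss_le_risk a th) (riskW th).
have : ((N%:R * (#|low_sets|%:R * a ^+ 2))%:E <=
    \sum_(th : vertex) W + \sum_(th : vertex) W)%E.
  apply: (@le_trans _ _ (\sum_(th : vertex) \sum_(S | low_sets S)
    (coeff_loss a S th + coeff_loss a S (flip_vertex S th)))%E).
    apply: (@le_trans _ _ (\sum_(th : vertex) \sum_(S | low_sets S)
        (a ^+ 2)%:E)%E).
      under eq_bigr do rewrite sumEFin sumr_const.
      rewrite sumEFin sumr_const lee_fin -(mulr_natl (_ *+ _)).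
      by rewrite -(mulr_natl (a ^+ 2)).
    by apply: lee_sum => th _; apply: lee_sum => S lS; exact: coeff_loss_flip.
  under eq_bigr do rewrite big_split/=.
  rewrite big_split/=; apply: leeD; first exact: lee_sum.
  rewrite exchange_big/=.
  under eq_bigr => S _ do
    rewrite (reindex_inj (inv_inj (@flip_vertexK S)))/=.
  under eq_bigr do under eq_bigr do rewrite flip_vertexK.
  by rewrite exchange_big/=; apply: lee_sum.
case: W lossW {riskW} => [w|_ _|lossW]; last 2 first.
- by rewrite leey.
- have := le_trans (sume_ge0 _ _) (lossW [ffun=> false]).
  by rewrite leeNy_eq => h; have /eqP := h (fun S _ => coeff_loss_ge0 a S _).
move=> _; rewrite !sumEFin -EFinD !lee_fin !sumr_const -/N => h.
rewrite -(ler_pM2l N0); move: h; rewrite -!(mulr_natl w); lra.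
Qed.

End hypercube_lower_bound.

(** * Growth of the resolvable dimension *)

Section resolvable_degree.
Variables d n : nat.
Hypothesis n0 : (0 < n)%N.

Lemma Ndim0 : Ndim d 0 = 1%N.
Proof. by rewrite /Ndim big_nat1 bin0. Qed.

Lemma Ndim_Dstar : (Ndim d (Dstar d n) <= n)%N.
Proof.
rewrite /Dstar; have [|D DP ->] :=
  @eq_bigmax_cond _ (fun D : 'I_d.+1 => (Ndim d D <= n)%N) (@nat_of_ord d.+1).
  by apply/card_gt0P; exists ord0; rewrite unfold_in /= Ndim0.
exact: DP.
Qed.

Lemma lt_Ndim_DstarS : (Dstar d n < d)%N -> (n < Ndim d (Dstar d n).+1)%N.
Proof.
move=> Dd; rewrite ltnNge; apply/negP => DP.
have DP' : ((Dstar d n).+1 < d.+1)%N by [].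
suff : ((Dstar d n).+1 <= Dstar d n)%N by rewrite ltnn.
exact: (@leq_bigmax_cond _ (fun D : 'I_d.+1 => (Ndim d D <= n)%N) _ (Ordinal DP')).
Qed.

End resolvable_degree.

Section geometric_growth.
Context (R : realType).

(** Term by term: ['C(d, j+1) / 'C(d, j) = (d - j) / (j + 1)], which is at
    least [q] for [j <= D]. *)
Lemma Ndim_growth_step (q : R) (d D : nat) : 0 <= q ->
  (q + 1) * D.+1%:R <= d%:R ->
  q * (Ndim d D)%:R <= (Ndim d D.+1)%:R.
Proof.
move=> q0 qd.
have step j : (j <= D)%N -> q * 'C(d, j)%:R <= 'C(d, j.+1)%:R.
  move=> jD; have jR : (j%:R <= D%:R :> R) by rewrite ler_nat.
  have D0 : 0 <= D%:R :> R by [].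
  have jd : (j <= d)%N.
    by rewrite -(ler_nat R); move: qd; rewrite -natr1; nra.
  rewrite -(@ler_pM2l _ j.+1%:R) ?ltr0n// -natrM mul_bin_left natrM natrB//.
  rewrite mulrA ler_wpM2r// lerBrDr; apply: le_trans qd.
  rewrite mulrC -[in leRHS]natr1 -[in leLHS]natr1; nra.
rewrite /Ndim mulrC (big_nat_recl D.+1)//= natrD mulrC.
rewrite -[leLHS]add0r lerD// !natr_sum mulr_sumr !big_mkord.
by apply: ler_sum => j _; apply: step; rewrite -ltnS.
Qed.

Lemma Ndim_growth (q : R) (d m i : nat) : 0 <= q -> (q + 1) * m.+1%:R <= d%:R ->
  (i <= m)%N -> q ^+ i * (Ndim d (m - i))%:R <= (Ndim d m)%:R.
Proof.
move=> q0 qd; elim: i => [|i IH] im; first by rewrite subn0 mul1r.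
apply: le_trans (IH (ltnW im)); rewrite exprSr -mulrA ler_wpM2l ?exprn_ge0//.
rewrite (_ : m - i = (m - i.+1).+1)%N; last by lia.
apply: Ndim_growth_step => //; apply: le_trans qd.
rewrite ler_wpM2l ?addr_ge0// ler_nat; lia.
Qed.

Lemma bernoulli_ineq (h : R) i : 0 <= h -> 1 + i%:R * h <= (1 + h) ^+ i.
Proof.
move=> h0; elim: i => [|i IH]; first by rewrite mul0r addr0 expr0.
have i0 : 0 <= i%:R :> R by [].
rewrite exprS -natr1; nra.
Qed.

(** With [(1 + h) ^ 2 <= q], Bernoulli's inequality applied to [1 + h] and then
    squared gives growth at least quadratic in the exponent. *)
Lemma geometric_beats_linear (q A : R) : 1 < q ->
  exists2 D0, (0 < D0)%N & forall m, (D0 <= m)%N ->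
    A * m%:R <= q ^+ uphalf m.
Proof.
move=> q1.
(* [(1 + h) ^ 2 <= 1 + 3 h <= q] because [h <= 1]. *)
pose h := Num.min (1 : R) ((q - 1) / 3).
have h0 : 0 < h by rewrite lt_min ltr01/= divr_gt0// subr_gt0.
have h1 : h <= 1 by rewrite ge_min lexx.
have h2 : 3 * h <= q - 1.
  by rewrite mulrC -ler_pdivlMr// ge_min lexx orbT.
have hq : (1 + h) ^+ 2 <= q by rewrite expr2; nra.
exists (Num.truncn (4 * `|A| / h ^+ 2)).+1 => // m Dm.
have mA : 4 * `|A| <= m%:R * h ^+ 2.
  rewrite -ler_pdivrMr ?exprn_gt0//; apply/ltW.
  apply: lt_le_trans (truncnS_gt _) _; first by rewrite ler_nat.
have um : m%:R <= 2 * (uphalf m)%:R :> R.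
  by rewrite -natrM ler_nat mul2n uphalfE; lia.
set i := uphalf m in um *.
have m0 : 0 <= m%:R :> R by [].
have := bernoulli_ineq i (ltW h0) => bern.
apply: (@le_trans _ _ (((1 + h) ^+ i) ^+ 2)); last first.
  by rewrite -exprM mulnC exprM lerXn2r// nnegrE ?exprn_ge0//; lra.
have hi : m%:R * h <= 2 * (1 + h) ^+ i.
  by move: bern um; nra.
have : (m%:R * h) ^+ 2 <= 4 * ((1 + h) ^+ i) ^+ 2.
  rewrite [leRHS](_ : _ = (2 * (1 + h) ^+ i) ^+ 2); last by ring.
  by rewrite lerXn2r// nnegrE; nra.
have := ler_norm A; move: mA m0; rewrite exprMn; nra.
Qed.

End geometric_growth.

(** * The minimax rate *)

Lemma half_le m : (m./2 <= m)%N. Proof. by lia. Qed.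

Lemma uphalf_le m : (uphalf m <= m)%N. Proof. by lia. Qed.

Lemma subn_uphalf m : (m - uphalf m)%N = m./2. Proof. by lia. Qed.

Section minimax_bounds.
Context (R : realType) (d n : nat) (B s2 : R).
Hypotheses (n0 : (0 < n)%N) (B0 : 0 < B) (s20 : 0 < s2).
Notation m := (Dstar d n).
Hypothesis m0 : (0 < m)%N.

Let nR0 : 0 < n%:R :> R. Proof. by rewrite ltr0n. Qed.
Let mR0 : 0 < m%:R :> R. Proof. by rewrite ltr0n. Qed.

(** The cutoff [m / 2] is admissible because [N(d, m / 2)] is at most
    [(kappa - 1) ^ - (m - m / 2) * N(d, m)] and [N(d, m) <= n]. *)
Lemma half_Dstar_admissible (V kappa : R) : 0 <= V -> 2 < kappa ->
  kappa * m.+1%:R <= d%:R ->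
  (4 * V / B) * m%:R <= (kappa - 1) ^+ uphalf m ->
  cutoff_admissible d n B V m./2.
Proof.
move=> V0 k2 kd growth; have q0 : 0 < kappa - 1 by lra.
rewrite /cutoff_admissible; apply/andP; split; first exact: half_le.
have := @Ndim_growth _ (kappa - 1) d m (uphalf m) (ltW q0).
rewrite subrK subn_uphalf => /(_ kd (uphalf_le m)) hN.
have Nn : (Ndim d m)%:R <= n%:R :> R by rewrite ler_nat Ndim_Dstar.
rewrite ler_pdivlMr ?mulr_gt0// mulrAC ler_pdivrMr//.
move: growth; rewrite mulrAC ler_pdivrMr// => growth.
apply: (@le_trans _ _ ((kappa - 1) ^+ uphalf m * B * (Ndim d m./2)%:R)).
  rewrite [leLHS](_ : _ = 4 * V * m%:R * (Ndim d m./2)%:R); last by ring.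
  by rewrite ler_wpM2r.
by rewrite mulrAC mulrC ler_wpM2l ?(ltW B0)//; exact: le_trans hN Nn.
Qed.

Lemma balanced_cutoff_spec (V : R) D : cutoff_admissible d n B V D ->
  (D <= balanced_cutoff d n B V)%N /\
  cutoff_admissible d n B V (balanced_cutoff d n B V).
Proof.
move=> DP; have Dm : (D < m.+1)%N by case/andP: DP.
split.
  exact: (@leq_bigmax_cond _ (fun D : 'I_m.+1 => cutoff_admissible d n B V D)
    (@nat_of_ord m.+1) (Ordinal Dm)).
rewrite /balanced_cutoff; have [|E EP ->] :=
  @eq_bigmax_cond _ (fun D : 'I_m.+1 => cutoff_admissible d n B V D)
    (@nat_of_ord m.+1); last exact: EP.
by apply/card_gt0P; exists (Ordinal Dm).
Qed.

Lemma balanced_projection_worst_risk :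
  let V := s2 + B / 4 in
  cutoff_admissible d n B V m./2 ->
  (worst_risk s2 (sobolev_ellipsoid d B)
     (@emp_projection R d n (balanced_cutoff d n B V))
   <= (3 * (B / m%:R))%:E)%E.
Proof.
move=> V /balanced_cutoff_spec; set D := balanced_cutoff _ _ _ _.
move=> [mD /andP[_ DV]].
apply/ereal_supP => _ [f fB <-]; apply/ereal_supP => _ [P Ps <-].
apply: le_trans (emp_projection_risk D n0 s20 Ps fB) _; rewrite lee_fin.
apply: (@le_trans _ _ (8 * (B / (4 * m%:R)) + B / (2 * m%:R))); last first.
  rewrite [leLHS](_ : _ = 5 / 2 * (B / m%:R)); last first.
    by field; rewrite gt_eqF.
  by rewrite ler_wpM2r ?divr_ge0 ?ltW//; lra.
apply: lerD.
  apply: (@le_trans _ _ (8 * (V * (Ndim d D)%:R / n%:R))); last first.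
    by rewrite ler_pM2l.
  rewrite [leRHS](_ : _ = (Ndim d D)%:R * (8 * V / n%:R)); last first.
    by field; rewrite gt_eqF.
  rewrite ler_wpM2l// ler_pM2r ?invr_gt0// /V mulrDr addrC lerD2l.
  by rewrite ler_peMl ?divr_ge0 ?ler1n// ltW.
rewrite ler_pM2l// lef_pV2 ?posrE ?mulr_gt0//.
by rewrite -!natrM ler_nat; lia.
Qed.

(** The hypothesis [B / (2 * s2) <= m + 1] makes [n a ^ 2 / (2 s2)] at most
    1/4, the threshold at which two neighbouring sign patterns are hard to
    tell apart. *)
Lemma minimax_lower_bound : (m < d)%N -> B / (2 * s2) <= m.+1%:R ->
  (((1 / 16) * (B / m%:R))%:E <= minimax_risk n s2 (sobolev_ellipsoid d B))%E.
Proof.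
move=> md Bm; apply/ereal_infP => _ [fh fh_est <-].
set k := m.+1; pose M : R := #|@low_sets d k|%:R.
have kR0 : 0 < k%:R :> R by rewrite ltr0n.
have nM : n%:R <= M.
  by rewrite ler_nat -ltnS card_low_sets; exact: lt_Ndim_DstarS.
have M0 : 0 < M by exact: lt_le_trans nM.
(* The largest amplitude that keeps all the test functions in the ellipsoid. *)
pose a := Num.sqrt (B / (4 * (k%:R * M))).
have a2 : a ^+ 2 = B / (4 * (k%:R * M)).
  by rewrite sqr_sqrtr// divr_ge0 ?ltW// !mulr_gt0.
pose s := Num.sqrt s2.
have ss : s ^+ 2 = s2 by rewrite sqr_sqrtr// ltW.
have s0 : s != 0 by rewrite gt_eqF// sqrtr_gt0.
have na : n%:R * (a ^+ 2 / (2 * s ^+ 2)) <= 1 / 4.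
  apply: (@le_trans _ _ (M * (a ^+ 2 / (2 * s ^+ 2)))).
    by rewrite ler_wpM2r// divr_ge0 ?sqr_ge0// ss mulr_ge0// ltW.
  rewrite a2 ss [leLHS](_ : _ = B / (2 * s2) / k%:R / 4); last first.
    by field; rewrite !gt_eqF.
  by rewrite ler_pM2r// ler_pdivrMr// mul1r.
have riskW th : (risk (gaussian_noise s) fh (vertex_fun k a th) <=
    worst_risk s2 (sobolev_ellipsoid d B) fh)%E.
  apply: (@le_trans _ _ (ereal_sup [set risk P fh (vertex_fun k a th) |
      P in sub_gaussian_noise s2])).
    apply: ereal_sup_ubound; exists (gaussian_noise s) => //.
    by rewrite -ss; exact: gaussian_sub_gaussian.
  apply: ereal_sup_ubound; exists (vertex_fun k a th) => //.
  apply: vertex_ellipsoid; rewrite a2 -/M le_eqVlt; apply/orP; left; apply/eqP.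
  by field; rewrite !gt_eqF.
apply: le_trans (assouad s0 fh_est na riskW); rewrite lee_fin -/M a2.
rewrite [leRHS](_ : _ = 1 / 8 * (B / k%:R)); last first.
  by field; rewrite !gt_eqF.
have km : k%:R <= 2 * m%:R :> R by rewrite -natrM ler_nat /k; lia.
rewrite [leLHS](_ : _ = 1 / 8 * (B / (2 * m%:R))); last first.
  by field; rewrite gt_eqF.
by rewrite ler_pM2l ?divr_gt0// ler_pM2l// lef_pV2 ?posrE ?mulr_gt0.
Qed.

End minimax_bounds.
Theorem theorem4p2 (R : realType) :
  exists c C : R, 0 < c /\ c < C /\
  forall B s2 kappa : R, 0 < B -> 0 < s2 -> 2 < kappa ->
  exists D0 : nat, (1 <= D0)%N /\
    (forall d n : nat, (0 < d)%N -> (0 < n)%N ->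
      kappa * ((Dstar d n).+1)%:R <= d%:R -> (D0 <= Dstar d n)%N ->
      ((c * (B / (Dstar d n)%:R))%:E
        <= minimax_risk n s2 (sobolev_ellipsoid d B))%E /\
      (minimax_risk n s2 (sobolev_ellipsoid d B)
        <= (C * (B / (Dstar d n)%:R))%:E)%E /\
      (let V := s2 + B / 4 in
       let fh := @emp_projection R d n (balanced_cutoff d n B V) in
       (exists D : nat, cutoff_admissible d n B V D) /\
       is_estimator fh /\
       (worst_risk s2 (sobolev_ellipsoid d B) fh
         <= (C * (B / (Dstar d n)%:R))%:E)%E)) /\
    (forall d_ n_ : nat -> nat,
      (forall k, (0 < d_ k)%N /\ (0 < n_ k)%N) ->
      (fun k => Dstar (d_ k) (n_ k)) @ \oo --> \oo ->
      (\forall k \near \oo,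
        kappa * ((Dstar (d_ k) (n_ k)).+1)%:R <= (d_ k)%:R) ->
      \forall k \near \oo,
        kappa * ((Dstar (d_ k) (n_ k)).+1)%:R <= (d_ k)%:R /\
        (D0 <= Dstar (d_ k) (n_ k))%N /\
        ((c * (B / (Dstar (d_ k) (n_ k))%:R))%:E
          <= minimax_risk (n_ k) s2 (sobolev_ellipsoid (d_ k) B))%E /\
        (minimax_risk (n_ k) s2 (sobolev_ellipsoid (d_ k) B)
          <= (C * (B / (Dstar (d_ k) (n_ k))%:R))%:E)%E).

Proof.
exists (1 / 16), 3; split; first by lra.
split; first by lra.
move=> B s2 kappa B0 s20 k2.
have [D1 D10 growth] :=
  @geometric_beats_linear R (kappa - 1) (4 * (s2 + B / 4) / B) ltac:(lra).
(* [D1] serves the upper bound, [D2] the lower bound. *)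
pose D2 := (Num.truncn (B / (2 * s2))).+1.
exists (maxn D1 D2); split; first by rewrite leq_max D10.
have main (d n : nat) : (0 < d)%N -> (0 < n)%N ->
    kappa * ((Dstar d n).+1)%:R <= d%:R -> (maxn D1 D2 <= Dstar d n)%N ->
    [/\ ((1 / 16 * (B / (Dstar d n)%:R))%:E <=
          minimax_risk n s2 (sobolev_ellipsoid d B))%E,
        cutoff_admissible d n B (s2 + B / 4) (Dstar d n)./2 &
        (worst_risk s2 (sobolev_ellipsoid d B)
          (@emp_projection R d n (balanced_cutoff d n B (s2 + B / 4)))
          <= (3 * (B / (Dstar d n)%:R))%:E)%E].
  move=> d0 n0 kd; rewrite geq_max => /andP[D1m D2m].
  have m0 : (0 < Dstar d n)%N by exact: leq_trans D1m.
  have adm : cutoff_admissible d n B (s2 + B / 4) (Dstar d n)./2.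
    apply: (half_Dstar_admissible n0 B0 m0 _ k2 kd); last exact: growth.
    by rewrite addr_ge0// ?divr_ge0// ltW.
  split=> //; last exact: balanced_projection_worst_risk.
  apply: minimax_lower_bound => //.
    rewrite -(ltr_nat R); apply: lt_le_trans kd; rewrite -natr1.
    by have : 0 <= (Dstar d n)%:R :> R by []; nra.
  apply/ltW/(lt_le_trans (truncnS_gt _)).
  by rewrite ler_nat -/D2; exact: leq_trans D2m (leqnSn _).
have upper (d n : nat) (W : \bar R) :
    (worst_risk s2 (sobolev_ellipsoid d B)
      (@emp_projection R d n (balanced_cutoff d n B (s2 + B / 4))) <= W)%E ->
    (minimax_risk n s2 (sobolev_ellipsoid d B) <= W)%E.
  apply: le_trans; apply: ereal_inf_lbound.
  exists (@emp_projection R d n (balanced_cutoff d n B (s2 + B / 4))) => //.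
  exact: emp_projection_estimator.
split=> [d n d0 n0 kd Dm|d_ n_ dn0 Doo kd].
  have [lo adm up] := main d n d0 n0 kd Dm.
  split=> //; split; first exact: upper.
  split; first by exists (Dstar d n)./2.
  by split=> //; exact: emp_projection_estimator.
have Dm : \forall k \near \oo, (maxn D1 D2 <= Dstar (d_ k) (n_ k))%N.
  by move/cvgnyPge: Doo; apply.
near=> k.
have kdk : kappa * ((Dstar (d_ k) (n_ k)).+1)%:R <= (d_ k)%:R by near: k.
have Dmk : (maxn D1 D2 <= Dstar (d_ k) (n_ k))%N by near: k.
have [d0 n0] := dn0 k.
have [lo _ up] := main _ _ d0 n0 kdk Dmk.
by split=> //; split=> //; split=> //; exact: upper.
Unshelve. all: by end_near.
Qed.
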